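(* Every total function computed by a single-use Mealy machine is a composition of primes, i.e. it can be obtained by sequential and parallel composition from: (1) length-preserving homomorphisms $\Sigma^*\to\Gamma^*$ obtained by lifting letterwise an equivariant function $\Sigma\to\Gamma$ between polynomial orbit-finite sets; (2) functions computed by classical Mealy machines; (3) the atom propagation function.
   Context: Fix a countably infinite set $\mathbb A$ of atoms. A polynomial orbit-finite set is built from $\mathbb A$ and singleton sets by finite products and finite disjoint unions (finite sets are a special case); atom automorphisms (bijections of $\mathbb A$) act naturally; a function $f$ is equivariant if $f(\pi(x))=\pi(f(x))$ for every atom automorphism $\pi$. A single-use Mealy machine has polynomial orbit-finite input/output alphabets $\Sigma,\Gamma$, finitely many states with an initial state, finitely many registers holding an atom or $\bot$ (initially all $\bot$), and a deterministic transition function assigning to each state a question and, for each answer, a next state and an action. Questions: apply an equivariant function $\Sigma\to\{\mathrm{yes},\mathrm{no}\}$ to the current letter; or test equality of two registers (rejecting if either is $\bot$), after which both registers are set to $\bot$. Actions: store the value of an equivariant function $\Sigma\to\mathbb A+\bot$ of the current letter in a register; or output $f(r_1,\dots,r_k)$ for an equivariant $f:\mathbb A^k\to\Gamma$ and distinct registers $r_1,\dots,r_k$ (rejecting if one is $\bot$), setting these registers to $\bot$ and moving the head to the next position. There are no endmarkers; the run starts at the first position and succeeds when the head leaves the word to the right; the machine computes a length-preserving partial function $\Sigma^*\to\Gamma^*$. A classical Mealy machine has finite $\Sigma,\Gamma$, finite state set, initial state and transition function $Q\times\Sigma\to Q\times\Gamma$, computing the length-preserving function outputting one letter per transition. Atom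 propagation is the length-preserving function $(\mathbb A+\{\epsilon,\downarrow\})^*\to(\mathbb A+\bot)^*$ whose output at position $i$ is the atom at position $j$ if position $i$ has label $\downarrow$, $j<i$ has an atom label and all positions strictly between $j$ and $i$ have label $\epsilon$; otherwise the output is $\bot$. Sequential composition is $g\circ f$; parallel composition of length-preserving $f_i:\Sigma_i^*\to\Gamma_i^*$ is $f_1|f_2:(\Sigma_1\times\Sigma_2)^*\to(\Gamma_1\times\Gamma_2)^*$ applying $f_i$ to the $i$-th projection of the input. *)

(* Defs.v *)
From mathcomp Require Import all_boot.
Set Implicit Arguments.
Unset Strict Implicit.
Unset Printing Implicit Defensive.

(** Atoms: the countably infinite set nat.  Atom automorphisms: bijections
    pi : nat -> nat (ssrfun's [bijective]). *)

Inductive pof : Type :=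
| PAtom
| PUnit
| PEmpty
| PProd of pof & pof
| PSum of pof & pof.

Fixpoint el (X : pof) : Type :=
  match X with
  | PAtom => nat
  | PUnit => unit
  | PEmpty => Empty_set
  | PProd A B => (el A * el B)%type
  | PSum A B => (el A + el B)%type
  end.

Fixpoint act (pi : nat -> nat) (X : pof) : el X -> el X :=
  match X return el X -> el X with
  | PAtom => pi
  | PUnit => id
  | PEmpty => id
  | PProd A B => fun x => (@act pi A x.1, @act pi B x.2)
  | PSum A B => fun x => match x with
                         | inl a => inl (@act pi A a)
                         | inr b => inr (@act pi B b)
                         end
  end.
Arguments act pi X : clear implicits.

Definition equivariant (X Y : pof) (f : el X -> el Y) : Prop :=
  forall pi : nat -> nat, bijective pi -> forall x, f (act pi X x) = act pi Y (f x).

(** Finite polynomial orbit-finite sets: those not mentioning atoms. *)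
Fixpoint atomfree (X : pof) : bool :=
  match X with
  | PAtom => false
  | PUnit | PEmpty => true
  | PProd A B | PSum A B => atomfree A && atomfree B
  end.

Inductive question (S : pof) (n : nat) : Type :=
| QTest of (el S -> bool)
| QEq of 'I_n & 'I_n.

Inductive action (S G : pof) (n : nat) : Type :=
| AStore of (el S -> option nat) & 'I_n
| AOut (rs : seq 'I_n) of (seq nat -> el G).
    (* output f(r_1,...,r_k), k = size rs; f only matters on lists of length k *)

Record sumealy (S G : pof) : Type := SUMealy {
  nstates : nat;
  nregs : nat;
  init : 'I_nstates;
  question_of : 'I_nstates -> question S nregs;
  next : 'I_nstates -> bool -> 'I_nstates * action S G nregs
}.
Arguments init {S G} s.
Arguments question_of {S G} s _.
Arguments next {S G} s _ _.
Arguments nstates {S G} s.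
Arguments nregs {S G} s.

Definition equiv_question (S : pof) n (qu : question S n) : Prop :=
  match qu with
  | QTest f => forall pi : nat -> nat, bijective pi -> forall a, f (act pi S a) = f a
  | QEq _ _ => True
  end.

Definition wf_action (S G : pof) n (ac : action S G n) : Prop :=
  match ac with
  | AStore f _ => forall pi : nat -> nat, bijective pi ->
                    forall a, f (act pi S a) = omap pi (f a)
  | AOut rs f => uniq rs /\
      forall pi : nat -> nat, bijective pi ->
        forall xs : seq nat, size xs = size rs -> f (map pi xs) = act pi G (f xs)
  end.

Definition wf_sumealy (S G : pof) (M : sumealy S G) : Prop :=
  forall q, equiv_question (question_of M q) /\
            forall b, wf_action (next M q b).2.

(** register valuations; None = bot *)
Definition val (n : nat) := 'I_n -> option nat.

Definition upd n (v : val n) (r : 'I_n) (x : option nat) : val n :=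
  fun r' => if r' == r then x else v r'.

(** answering a question; None = reject *)
Definition answer (S : pof) n (qu : question S n) (v : val n) (a : el S)
  : option (bool * val n) :=
  match qu with
  | QTest f => Some (f a, v)
  | QEq r1 r2 =>
      match v r1, v r2 with
      | Some x1, Some x2 => Some (x1 == x2, upd (upd v r1 None) r2 None)
      | _, _ => None
      end
  end.

Fixpoint get_all (s : seq (option nat)) : option (seq nat) :=
  match s with
  | [::] => Some [::]
  | Some x :: s' => omap (cons x) (get_all s')
  | None :: _ => None
  end.

(** performing an action; None = reject; Some (v', None) = head stays,
    Some (v', Some y) = output y and move the head right. *)
Definition perform (S G : pof) n (ac : action S G n) (v : val n) (a : el S)
  : option (val n * option (el G)) :=
  match ac with
  | AStore f r => Some (upd v r (f a), None)
  | AOut rs f =>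
      match get_all (map v rs) with
      | Some xs => Some (foldr (fun r v' => upd v' r None) v rs, Some (f xs))
      | None => None
      end
  end.

(** [runs M q v w out]: started in state q with valuation v and the head on
    the first letter of the remaining word w, the run succeeds (head leaves
    the word to the right) producing output out. *)
Inductive runs (S G : pof) (M : sumealy S G)
  : 'I_(nstates M) -> val (nregs M) -> seq (el S) -> seq (el G) -> Prop :=
| runs_end q v : @runs S G M q v [::] [::]
| runs_stay q v a w b v1 v2 out :
    answer (question_of M q) v a = Some (b, v1) ->
    perform (next M q b).2 v1 a = Some (v2, None) ->
    @runs S G M (next M q b).1 v2 (a :: w) out ->
    @runs S G M q v (a :: w) out
| runs_move q v a w b v1 v2 y out :
    answer (question_of M q) v a = Some (b, v1) ->
    perform (next M q b).2 v1 a = Some (v2, Some y) ->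
    @runs S G M (next M q b).1 v2 w out ->
    @runs S G M q v (a :: w) (y :: out).

Arguments runs {S G} M _ _ _ _.

Definition su_computes (S G : pof) (M : sumealy S G) (w : seq (el S)) (out : seq (el G)) :=
  runs M (init M) (fun _ => None) w out.

(** Classical Mealy machines (finite alphabets = atom-free pofs). *)

Fixpoint mealy_run (X Y : pof) m (delta : 'I_m -> el X -> 'I_m * el Y)
  (q : 'I_m) (w : seq (el X)) : seq (el Y) :=
  match w with
  | [::] => [::]
  | a :: w' => (delta q a).2 :: mealy_run delta (delta q a).1 w'
  end.

Definition classical_mealy_function (X Y : pof) (f : seq (el X) -> seq (el Y)) : Prop :=
  atomfree X /\ atomfree Y /\
  exists (m : nat) (q0 : 'I_m) (delta : 'I_m -> el X -> 'I_m * el Y),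
    forall w, f w = mealy_run delta q0 w.

Definition PropIn : pof := PSum PAtom (PSum PUnit PUnit).
Definition PropOut : pof := PSum PAtom PUnit.
(* eps = inr (inl tt), down = inr (inr tt) *)

Definition is_eps (x : el PropIn) : bool :=
  match x with inr (inl _) => true | _ => false end.
Definition is_down (x : el PropIn) : bool :=
  match x with inr (inr _) => true | _ => false end.

Definition atom_prop_at (w : seq (el PropIn)) (i : nat) : el PropOut :=
  match nth (inr (inl tt)) w i with
  | inr (inr _) =>
      match rev (filter (fun x => ~~ is_eps x) (take i w)) with
      | inl a :: _ => inl a
      | _ => inr tt
      end
  | _ => inr tt
  end.

Definition atom_propagation (w : seq (el PropIn)) : seq (el PropOut) :=
  mkseq (atom_prop_at w) (size w).

Definition par (X1 Y1 X2 Y2 : pof) (f1 : seq (el X1) -> seq (el Y1))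
  (f2 : seq (el X2) -> seq (el Y2)) : seq (el (PProd X1 X2)) -> seq (el (PProd Y1 Y2)) :=
  fun w => zip (f1 (unzip1 w)) (f2 (unzip2 w)).

Inductive prime_comp : forall X Y : pof, (seq (el X) -> seq (el Y)) -> Prop :=
| pc_hom X Y (h : el X -> el Y) : equivariant h -> prime_comp (map h)
| pc_mealy X Y (f : seq (el X) -> seq (el Y)) :
    classical_mealy_function f -> prime_comp f
| pc_prop : prime_comp atom_propagation
| pc_seq X Y Z (f : seq (el X) -> seq (el Y)) (g : seq (el Y) -> seq (el Z)) :
    prime_comp f -> prime_comp g -> prime_comp (g \o f)
| pc_par X1 Y1 X2 Y2 (f1 : seq (el X1) -> seq (el Y1)) (f2 : seq (el X2) -> seq (el Y2)) :
    prime_comp f1 -> prime_comp f2 -> prime_comp (par f1 f2).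

(* Main.v *)
Require Import Defs.
From mathcomp Require Import all_boot.
Set Implicit Arguments.
Unset Strict Implicit.
Unset Printing Implicit Defensive.

(* Call a signal a function of the nonempty prefixes of the input.  It suffices
   to compute the control states of the machine, since the atom of each output
   can then be fetched by atom propagation.  While a letter is processed, the
   machine performs a finite tree of equality tests on its registers and on the
   atoms of the letter, so the machine becomes a letter-to-letter automaton
   labelled by such trees, in which each register is used at most once.

   The possible sets of live registers are eliminated one at a time.  Let [L] be
   a maximal one.  A letter acts on the configurations with live set [L] by a
   partial map: it carries a configuration whose registers it does not use to
   another control state.  The induction is on a bound [k] on the number of
   values of the maps that are not the identity.  A letter that is not the identity closes
   a block.  Inside a block a configuration of live set [L] never moves, so when
   one is born there, it is enough to store all its registers but one, which was
   just filled from the current letter.  The missing atom is needed only at the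
   end of the block, where it is sent by atom propagation from its place of
   birth.  That place is found by running, in parallel for each control [p] at
   the beginning of the block and each guess [g] of the results of the tests on
   the registers inherited by the block (one bit per register suffices, by
   single use), a copy of the machine that stores only the new registers and
   stops at the birth, hence never has live set [L].  At the end of the block, the
   configurations of live set [L] that are carried over get one of [k] names,
   chosen so that a block end either fixes all names or has fewer than [k]
   values. *)

(** * Signals and compositions of primes *)

(** There are [n.+1] elements, so the set is inhabited even for [n = 0]; the surplus element of
    [pfin #|F|] codes nothing and [decode] sends it to [None]. *)
Fixpoint pfin n : pof := if n is n'.+1 then PSum PUnit (pfin n') else PUnit.

Fixpoint pfin_enc n (i : nat) : el (pfin n) :=
  match n return el (pfin n) with
  | 0 => tt
  | n'.+1 => if i is i'.+1 then inr (pfin_enc n' i') else inl tt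
  end.

Fixpoint pfin_dec n : el (pfin n) -> nat :=
  match n return el (pfin n) -> nat with
  | 0 => fun _ => 0
  | n'.+1 => fun x => if x is inr y then (pfin_dec y).+1 else 0
  end.

Lemma pfin_encK n i : i <= n -> pfin_dec (pfin_enc n i) = i.
Proof. by elim: n i => [|n IH] [|i] //= /IH ->. Qed.

Lemma act_pfin pi n x : act pi (pfin n) x = x.
Proof. by elim: n x => [|n IH] //= [[]|x] //=; rewrite IH. Qed.

Lemma atomfree_pfin n : atomfree (pfin n).
Proof. by elim: n. Qed.

Definition code (F : finType) (x : F) : el (pfin #|F|) := pfin_enc _ (enum_rank x).

Definition decode (F : finType) (y : el (pfin #|F|)) : option F :=
  omap enum_val (insub (pfin_dec y) : option 'I_#|F|).

Lemma codeK (F : finType) : pcancel (@code F) (@decode F).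
Proof.
by move=> x; rewrite /decode /code pfin_encK ?(ltnW (ltn_ord _)) // valK /= enum_rankK.
Qed.

Definition acode (x : option nat) : el PropOut := if x is Some n then inl n else inr tt.
Definition adecode (x : el PropOut) : option nat := if x is inl n then Some n else None.

Lemma acodeK : cancel acode adecode.
Proof. by case. Qed.

Lemma adecode_act pi x : adecode (act pi PropOut x) = omap pi (adecode x).
Proof. by case: x. Qed.

Lemma acode_map pi x : acode (omap pi x) = act pi PropOut (acode x).
Proof. by case: x. Qed.

Lemma omap_inj (pi : nat -> nat) : injective pi -> injective (omap pi).
Proof. by move=> inj [x|] [y|] //= [/inj ->]. Qed.

(** * Computable signals *)

Section Signals.
Variable S : pof.
Implicit Types (a : el S) (h w : seq (el S)).

(* A causal length-preserving function, as a function of the current letter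
   and of the earlier letters, the most recent one first. *)
Definition signal T := el S -> seq (el S) -> T.

Fixpoint trace T (s : signal T) h w : seq T :=
  if w is a :: w' then s a h :: trace s (a :: h) w' else [::].

Lemma eq_trace T (s t : signal T) h w : s =2 t -> trace s h w = trace t h w.
Proof. by move=> st; elim: w h => //= a w IH h; rewrite st IH. Qed.

Lemma map_trace T U (s : signal T) (f : T -> U) h w :
  map f (trace s h w) = trace (fun a h => f (s a h)) h w.
Proof. by elim: w h => //= a w IH h; rewrite IH. Qed.

Lemma trace_rcons T (s : signal T) h w a :
  trace s h (rcons w a) = rcons (trace s h w) (s a (catrev w h)).
Proof. by elim: w h => //= b w IH h; rewrite IH. Qed.

Lemma trace_odflt T (s : signal (option T)) (x : el S -> T) h w o :
  trace s h w = map Some o -> trace (fun a h => odflt (x a) (s a h)) h w = o.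
Proof. by elim: w h o => [|a w IH] h [|z o] //= [-> /IH ->]. Qed.

Definition computable X (s : signal (el X)) : Prop :=
  exists g : seq (el S) -> seq (el X), prime_comp g /\ forall w, g w = trace s [::] w.

Lemma eq_computable X (s t : signal (el X)) :
  s =2 t -> @computable X s -> @computable X t.
Proof. by move=> st [g [pg gE]]; exists g; split=> // w; rewrite gE (eq_trace _ _ st). Qed.

Lemma computable_input : @computable S (fun a _ => a).
Proof.
exists (map id); split; first exact: pc_hom.
by move=> w; rewrite map_id; elim: w [::] => //= a w IH h; rewrite -IH.
Qed.

Lemma computable_map X Y (s : signal (el X)) (f : el X -> el Y) :
  equivariant f -> @computable X s -> @computable Y (fun a h => f (s a h)).
Proof.
move=> ef [g [pg gE]]; exists (map f \o g); split; first exact: pc_seq pg (pc_hom ef).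
by move=> w /=; rewrite gE map_trace.
Qed.

Lemma computable_pair X Y (s : signal (el X)) (t : signal (el Y)) :
  @computable X s -> @computable Y t ->
  @computable (PProd X Y) (fun a h => (s a h, t a h)).
Proof.
move=> [g [pg gE]] [g' [pg' gE']].
pose diag (x : el S) : el (PProd S S) := (x, x).
have ed : equivariant diag by [].
exists (par g g' \o map diag); split; first exact: pc_seq (pc_hom ed) (pc_par pg pg').
move=> w; rewrite /par /= /unzip1 /unzip2 -!map_comp !map_id gE gE'.
by elim: w [::] => //= a w IH h; rewrite IH.
Qed.

Definition fin_sig (F : finType) (s : signal F) : Prop :=
  @computable (pfin #|F|) (fun a h => code (s a h)).

Definition at_sig (s : signal (option nat)) : Prop :=
  @computable PropOut (fun a h => acode (s a h)).

Lemma eq_fin_sig (F : finType) (s t : signal F) : s =2 t -> fin_sig s -> fin_sig t.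
Proof. by move=> st; apply: eq_computable => a h; rewrite st. Qed.

Lemma eq_at_sig (s t : signal (option nat)) : s =2 t -> at_sig s -> at_sig t.
Proof. by move=> st; apply: eq_computable => a h; rewrite st. Qed.

Lemma fin_sig_input (F : finType) (f : el S -> F) :
  (forall pi : nat -> nat, bijective pi -> forall a, f (act pi S a) = f a) ->
  fin_sig (fun a _ => f a).
Proof.
move=> ef; apply: (@computable_map S _ (fun a _ => a) (fun a => code (f a))).
  by move=> pi bpi x; rewrite ef // act_pfin.
exact: computable_input.
Qed.

Lemma at_sig_input (f : el S -> option nat) :
  (forall pi : nat -> nat, bijective pi -> forall a, f (act pi S a) = omap pi (f a)) ->
  at_sig (fun a _ => f a).
Proof.
move=> ef; apply: (@computable_map S _ (fun a _ => a) (fun a => acode (f a))).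
  by move=> pi bpi x; rewrite ef // acode_map.
exact: computable_input.
Qed.

Lemma fin_sig_map (F F' : finType) (f : F -> F') (s : signal F) :
  fin_sig s -> fin_sig (fun a h => f (s a h)).
Proof.
move=> cs.
pose g (x : el (pfin #|F|)) : el (pfin #|F'|) :=
  if decode x is Some y then code (f y) else pfin_enc _ 0.
apply: (@eq_computable _ (fun a h => g (code (s a h)))) => [a h|].
  by rewrite /g codeK.
by apply: computable_map cs => pi _ x; rewrite !act_pfin.
Qed.

Lemma fin_sig_map2 (F1 F2 F' : finType) (f : F1 -> F2 -> F') (s : signal F1) (t : signal F2) :
  fin_sig s -> fin_sig t -> fin_sig (fun a h => f (s a h) (t a h)).
Proof.
move=> cs ct; have c := computable_pair cs ct.
pose g (x : el (PProd (pfin #|F1|) (pfin #|F2|))) : el (pfin #|F'|) :=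
  match decode x.1, decode x.2 with
  | Some y, Some z => code (f y z)
  | _, _ => pfin_enc _ 0
  end.
apply: (@eq_computable _ (fun a h => g (code (s a h), code (t a h)))) => [a h|].
  by rewrite /g /= !codeK.
by apply: computable_map c => pi _ x; rewrite /g /= !act_pfin.
Qed.

Lemma fin_sig_const (F : finType) (x : F) : fin_sig (fun _ _ => x).
Proof. exact: (@fin_sig_input F (fun _ => x)). Qed.

(** * Finite automata along a signal *)

Section Scan.
Variables (F F' : finType) (q0 : F') (delta : F' -> F -> F') (s : signal F).

Fixpoint scan h : F' := if h is a :: h' then delta (scan h') (s a h') else q0.

Lemma fin_sig_mealy (F'' : finType) (out : F' -> F -> F'') :
  fin_sig s -> fin_sig (fun a h => out (scan h) (s a h)).
Proof.
move=> [g [pg gE]].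
pose d (i : 'I_#|F'|) (x : el (pfin #|F|)) : 'I_#|F'| * el (pfin #|F''|) :=
  if decode x is Some y
  then (enum_rank (delta (enum_val i) y), code (out (enum_val i) y))
  else (i, pfin_enc _ 0).
exists (mealy_run d (enum_rank q0) \o g); split.
  apply: (pc_seq pg); apply: pc_mealy; split; first exact: atomfree_pfin.
  split; first exact: atomfree_pfin.
  by exists #|F'|, (enum_rank q0), d.
move=> w /=; rewrite gE -[q0]/(scan [::]).
by elim: w [::] => //= a w IH h; rewrite /d codeK /= !enum_rankK -IH.
Qed.

Lemma fin_sig_prev : fin_sig s -> fin_sig (fun _ h => scan h).
Proof. exact: (@fin_sig_mealy F' (fun q _ => q)). Qed.

Lemma fin_sig_scan : fin_sig s -> fin_sig (fun a h => scan (a :: h)).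
Proof. exact: (@fin_sig_mealy F' delta). Qed.

End Scan.

Lemma fin_sig_ffun (I : finType) (s : I -> signal bool) :
  (forall i, fin_sig (s i)) -> fin_sig (fun a h => [ffun i => s i a h]).
Proof.
move=> cs.
suff H (l : seq I) : fin_sig (fun a h => [ffun i => (i \in l) && s i a h]).
  apply: (eq_fin_sig _ (H (enum I))) => a h.
  by apply/ffunP=> i; rewrite !ffunE mem_enum.
elim: l => [|i l IH].
  apply: (eq_fin_sig _ (fin_sig_const ([ffun=> false] : {ffun I -> bool}))) => a h.
  by apply/ffunP=> i; rewrite !ffunE.
pose f (b : bool) (g : {ffun I -> bool}) := [ffun j => if j == i then b else g j].
apply: (eq_fin_sig _ (fin_sig_map2 f (cs i) IH)) => a h; apply/ffunP=> j.
by rewrite !ffunE in_cons; case: eqP => // ->.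
Qed.

Lemma fin_sig_eq (s t : signal (option nat)) :
  at_sig s -> at_sig t -> fin_sig (fun a h => s a h == t a h).
Proof.
move=> cs ct; have c := computable_pair cs ct.
pose g (x : el (PProd PropOut PropOut)) : el (pfin #|{: bool}|) :=
  code (adecode x.1 == adecode x.2).
apply: (@eq_computable _ (fun a h => g (acode (s a h), acode (t a h)))) => [a h|].
  by rewrite /g /= !acodeK.
apply: computable_map c => pi bpi x; rewrite act_pfin /g; congr code.
rewrite -[(act pi _ x).1]/(act pi PropOut x.1) -[(act pi _ x).2]/(act pi PropOut x.2).
by rewrite !adecode_act (inj_eq (omap_inj (bij_inj bpi))).
Qed.

Lemma at_sig_if (b : signal bool) (s t : signal (option nat)) :
  fin_sig b -> at_sig s -> at_sig t -> at_sig (fun a h => if b a h then s a h else t a h).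
Proof.
move=> cb cs ct; have c := computable_pair cb (computable_pair cs ct).
pose g (x : el (PProd (pfin #|{: bool}|) (PProd PropOut PropOut))) : el PropOut :=
  if decode x.1 is Some true then x.2.1 else x.2.2.
apply: (@eq_computable _ (fun a h => g (code (b a h), (acode (s a h), acode (t a h)))))
  => [a h|].
  by rewrite /g /= codeK; case: (b a h).
apply: computable_map c => pi bpi [x [y z]].
by rewrite /g [X in decode X]/= act_pfin [in RHS]/=; case: decode => [[]|].
Qed.

Lemma at_sig_none : at_sig (fun _ _ => None).
Proof. exact: (@at_sig_input (fun _ => None)). Qed.

Lemma at_sig_select (A : finType) (c : signal (option A)) (d : A -> signal (option nat)) :
  fin_sig c -> (forall i, at_sig (d i)) ->
  at_sig (fun a h => if c a h is Some i then d i a h else None).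
Proof.
move=> cc cd.
suff H (l : seq A) :
    at_sig (fun a h => if c a h is Some i then if i \in l then d i a h else None else None).
  apply: (eq_at_sig _ (H (enum A))) => a h.
  by case: (c a h) => // i; rewrite mem_enum.
elim: l => [|i l IH].
  by apply: (eq_at_sig _ at_sig_none) => a h; case: (c a h).
have cb : fin_sig (fun a h => c a h == Some i) := fin_sig_map (fun x => x == Some i) cc.
apply: (eq_at_sig _ (at_sig_if cb (cd i) IH)) => a h.
case: (c a h) => // j; rewrite in_cons (inj_eq (@Some_inj _)).
by case: eqP => [->|].
Qed.

(** * Atom propagation along a signal *)

Section Propagation.
Variable s : signal (el PropIn).

(** What a down letter placed right after the history would receive. An earlier down letter blocks
    all atoms before it, so each atom is delivered at most once. *)
Fixpoint propagated h : option nat :=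
  if h is a :: h' then
    match s a h' with
    | inl x => Some x
    | inr (inl _) => propagated h'
    | inr (inr _) => None
    end
  else None.

Lemma atom_prop_at_rcons u x i :
  i < size u -> atom_prop_at (rcons u x) i = atom_prop_at u i.
Proof.
move=> iu; rewrite /atom_prop_at nth_rcons iu.
by rewrite -cats1 takel_cat // ltnW.
Qed.

Lemma atom_propagation_rcons u x :
  atom_propagation (rcons u x) =
  rcons (atom_propagation u) (atom_prop_at (rcons u x) (size u)).
Proof.
rewrite /atom_propagation size_rcons /mkseq -addn1 iotaD map_cat /= add0n cats1.
congr rcons; apply/eq_in_map => i; rewrite mem_iota add0n => /andP[_ iu].
exact: atom_prop_at_rcons.
Qed.

Lemma propagatedE w :
  acode (propagated (rev w)) =
  if rev (filter (fun x => ~~ is_eps x) (trace s [::] w)) is inl a :: _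
  then inl a else inr tt.
Proof.
elim/last_ind: w => // w a IH; rewrite rev_rcons trace_rcons filter_rcons /=.
by rewrite -/(rev w); case: (s a (rev w)) => [x|[u|u]] //=; rewrite rev_rcons.
Qed.

Lemma computable_propagation : @computable PropIn s ->
  at_sig (fun a h => if is_down (s a h) then propagated h else None).
Proof.
move=> [g [pg gE]]; exists (atom_propagation \o g); split; first exact: pc_seq pg pc_prop.
move=> w /=; rewrite gE; elim/last_ind: w => // w a IH.
rewrite !trace_rcons atom_propagation_rcons IH; congr rcons.
rewrite /atom_prop_at nth_rcons ltnn eqxx -cats1 take_size_cat // -/(rev w).
by case: (s a (rev w)) => [x|[u|u]] //=; rewrite propagatedE.
Qed.

End Propagation.

(** * Cells with destructive reading *)

Section Memory.
Variables (put use : signal bool) (val : signal (option nat)).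

Fixpoint memory h : option nat :=
  if h is a :: h' then
    if put a h' then val a h' else if use a h' then None else memory h'
  else None.

Let parity := scan false addb put.

(** Writes alternate between the channels, and reads go to the channel of the last write. Writing
    the undefined value is sent as a down letter, which blocks older atoms. *)
Let channel b : signal (el PropIn) := fun a h =>
  if put a h && (parity h != b) then
    if val a h is Some x then inl x else inr (inr tt)
  else if use a h && (parity h == b) then inr (inr tt) else inr (inl tt).

(* A letter may both read the cell and overwrite it, which one copy of atom
   propagation cannot do; successive writes therefore alternate between two
   copies. *)
Lemma at_sig_memory : fin_sig put -> fin_sig use -> at_sig val ->
  at_sig (fun a h => if use a h then memory h else None).
Proof.
move=> cp cu cv.
have cpar : fin_sig (fun _ h => parity h) := fin_sig_prev _ _ cp.
have cch b : @computable PropIn (channel b).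
  have c1 : fin_sig (fun a h => put a h && (parity h != b)).
    exact: (fin_sig_map2 (fun x y => x && (y != b)) cp cpar).
  have c2 : fin_sig (fun a h => use a h && (parity h == b)).
    exact: (fin_sig_map2 (fun x y => x && (y == b)) cu cpar).
  pose g (x : el (PProd (pfin #|{: bool}|) (PProd (pfin #|{: bool}|) PropOut))) : el PropIn :=
    if decode x.1 is Some true then
      if x.2.2 is inl n then inl n else inr (inr tt)
    else if decode x.2.1 is Some true then inr (inr tt) else inr (inl tt).
  have c := computable_pair c1 (computable_pair c2 cv).
  apply: (@eq_computable _ (fun a h => g (code (put a h && (parity h != b)),
            (code (use a h && (parity h == b)), acode (val a h))))) => [a h|].
    rewrite /g /= !codeK /channel.
    by case: (_ && _); case: (_ && _); case: (val a h).
  apply: computable_map c => pi bpi [x [y z]].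
  have -> : act pi (PProd (pfin #|{: bool}|) (PProd (pfin #|{: bool}|) PropOut))
      (x, (y, z)) = (x, (y, act pi PropOut z)).
    by congr (_, (_, _)); exact: act_pfin.
  rewrite /g [in LHS]/fst [in LHS]/snd [in RHS]/fst [in RHS]/snd.
  by case: (decode x) => [[]|]; case: (decode y) => [[]|]; case: z.
(* Invariant: the cell contains the atom pending in the channel indexed by the current parity. *)
have mE h : propagated (channel (parity h)) h = memory h.
  elim: h => //= a h IH; rewrite {1}/channel.
  case pE: (put a h) => /=.
    by case: (parity h); case: (val a h).
  by rewrite addbF eqxx andbT; case: (use a h).
pose out b := fun a h => if is_down (channel b a h) then propagated (channel b) h else None.
have cout b : at_sig (out b) := computable_propagation (cch b).
have cif := at_sig_if cu (at_sig_if cpar (cout true) (cout false)) at_sig_none.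
apply: (eq_at_sig _ cif) => a h; case uE: (use a h) => //.
transitivity (out (parity h) a h); first by case: (parity h).
by rewrite /out /channel uE eqxx andbF /= mE.
Qed.

End Memory.

(** * Vectors of atoms and output letters *)

Fixpoint ppow n : pof := if n is n'.+1 then PProd PropOut (ppow n') else PUnit.

Fixpoint ppow_nth n : el (ppow n) -> nat -> option nat :=
  match n return el (ppow n) -> nat -> option nat with
  | 0 => fun _ _ => None
  | n'.+1 => fun x i => if i is i'.+1 then ppow_nth x.2 i' else adecode x.1
  end.

Fixpoint ppow_mk n (v : nat -> option nat) : el (ppow n) :=
  match n return el (ppow n) with
  | 0 => tt
  | n'.+1 => (acode (v 0), ppow_mk n' (fun i => v i.+1))
  end.

Lemma ppow_mkK n v i : i < n -> ppow_nth (ppow_mk n v) i = v i.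
Proof. by elim: n v i => [|n IH] v [|i] //= ; [rewrite acodeK | move/IH->]. Qed.

Lemma ppow_nth_act pi n (x : el (ppow n)) i :
  ppow_nth (act pi _ x) i = omap pi (ppow_nth x i).
Proof.
by elim: n x i => [|n IH] x [|i] //=; rewrite -adecode_act.
Qed.

Lemma computable_ppow n (s : nat -> signal (option nat)) :
  (forall i, i < n -> at_sig (s i)) ->
  @computable (ppow n) (fun a h => ppow_mk n (fun i => s i a h)).
Proof.
elim: n s => [|n IH] s cs.
  by apply: (@computable_map S PUnit (fun a _ => a) (fun _ => tt)) computable_input.
exact: computable_pair (cs 0 isT) (IH (fun i => s i.+1) (fun i => cs i.+1)).
Qed.

(* The current letter is an argument of [H] because an output alphabet may
   have no invariant element to serve as a default value. *)
Lemma computable_output X (F : finType) n (c : signal F) (d : 'I_n -> signal (option nat))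
    (H : el S -> F -> ('I_n -> option nat) -> el X) (H0 : el S -> el X) :
  equivariant H0 ->
  (forall a q v v', v =1 v' -> H a q v = H a q v') ->
  (forall pi, bijective pi -> forall a q v,
     H (act pi S a) q (fun i => omap pi (v i)) = act pi X (H a q v)) ->
  fin_sig c -> (forall i, at_sig (d i)) ->
  @computable X (fun a h => H a (c a h) (fun i => d i a h)).
Proof.
move=> eH0 extH eH cc cd.
pose d' (i : nat) : signal (option nat) := fun a h =>
  if insub i is Some j then d j a h else None.
have cd' i : i < n -> at_sig (d' i).
  by move=> iln; apply: (eq_at_sig _ (cd (Ordinal iln))) => a h; rewrite /d' insubT.
have cp := computable_pair computable_input (computable_pair cc (computable_ppow cd')).
pose g (x : el (PProd S (PProd (pfin #|F|) (ppow n)))) : el X :=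
  if decode x.2.1 is Some q then H x.1 q (fun i => ppow_nth x.2.2 i) else H0 x.1.
apply: (@eq_computable _ (fun a h => g (a, (code (c a h),
          ppow_mk n (fun i => d' i a h))))) => [a h|].
  rewrite /g /= codeK; apply: extH => i; rewrite ppow_mkK //.
  by rewrite /d' insubT //= => i_lt; congr (d _ a h); apply: val_inj.
apply: computable_map cp => pi bpi [x [y z]].
have -> : act pi (PProd S (PProd (pfin #|F|) (ppow n))) (x, (y, z)) =
    (act pi S x, (y, act pi (ppow n) z)).
  by congr (_, (_, _)); exact: act_pfin.
rewrite /g [in LHS]/fst [in LHS]/snd [in RHS]/fst [in RHS]/snd.
case: (decode y) => [q|]; last by rewrite [LHS]/= eH0.
by rewrite -eH //; apply: extH => i /=; rewrite ppow_nth_act.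
Qed.

End Signals.

(** * Register automata labelled by single-use trees *)

(* At a leaf, [f r = None] keeps register [r] and [f r = Some a] overwrites it
   with the atom in slot [a] of the current letter. *)
Inductive tree (Q R A : Type) : Type :=
| Ret of Q & (R -> option A)
| Cmp of R & (R + A) & tree Q R A & tree Q R A.
Arguments Ret {Q R A}.
Arguments Cmp {Q R A}.

Section Trees.
Variables (Q : finType) (R : finType) (A : finType).
Implicit Types (t : tree Q R A) (K : {set R}) (f : R -> option A) (r : R) (s : R + A).
Implicit Types (v : R -> option nat) (u : A -> option nat).

Definition operand v u s : option nat :=
  match s with inl r => v r | inr a => u a end.

Fixpoint leaf v u t : Q * (R -> option A) :=
  match t with
  | Ret q f => (q, f)
  | Cmp r s t1 t0 => if v r == operand v u s then leaf v u t1 else leaf v u t0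
  end.

Definition assign v u f : R -> option nat :=
  fun r => if f r is Some a then u a else v r.

Definition touched r s : {set R} := if s is inl r2 then [set r; r2] else [set r].

Variable live : Q -> {set R}.

(* [K] is the set of registers that hold an atom and have not been used yet. *)
Fixpoint single_use K t : Prop :=
  match t with
  | Ret q f => forall r, r \in live q -> f r = None -> r \in K
  | Cmp r s t1 t0 =>
      [/\ touched r s \subset K, single_use (K :\: touched r s) t1
        & single_use (K :\: touched r s) t0]
  end.

Lemma single_use_sub K K' t : K \subset K' -> single_use K t -> single_use K' t.
Proof.
elim: t K K' => [q f|r s t1 IH1 t0 IH0] K K' sub /=.
  by move=> H r rq /(H r rq); apply: (subsetP sub).
case=> H H1 H0; split; first exact: subset_trans sub.
- exact: IH1 (setSD _ sub) H1.
- exact: IH0 (setSD _ sub) H0.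
Qed.

Lemma mem_touched r s : r \in touched r s.
Proof. by case: s => [r2|a] /=; rewrite !inE eqxx. Qed.

Lemma leaf_keep K t v u r :
  single_use K t -> r \in live (leaf v u t).1 -> (leaf v u t).2 r = None -> r \in K.
Proof.
elim: t K => [q f|r1 s t1 IH1 t0 IH0] K /=; first by move=> H; apply: H.
by case=> _ H1 H0; case: ifP => _ l1 l2; [have := IH1 _ H1 l1 l2|have := IH0 _ H0 l1 l2];
  rewrite inE => /andP[].
Qed.

End Trees.

(** * Configurations and solvability *)

Section Runs.
Variables (S : pof) (R Q A Y : finType) (live : Q -> {set R}) (q0 : Q).
Variable tr : Y -> Q -> tree Q R A.

Section Configuration.
Variables (y : signal S Y) (d : A -> signal S (option nat)).

Definition next_conf (c : Q * (R -> option nat)) (u : A -> option nat) (t : tree Q R A) :=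
  ((leaf c.2 u t).1, assign c.2 u (leaf c.2 u t).2).

Fixpoint conf (h : seq (el S)) : Q * (R -> option nat) :=
  if h is a :: h' then
    next_conf (conf h') (fun i => d i a h') (tr (y a h') (conf h').1)
  else (q0, fun=> None).

Lemma conf_cons a h :
  conf (a :: h) = next_conf (conf h) (fun i => d i a h) (tr (y a h) (conf h).1).
Proof. by []. Qed.

End Configuration.

(** Quantifying over all computable labels and slot contents lets one automaton run on signals
    computed from others, as the elimination requires. *)
Definition solvable : Prop :=
  forall (y : signal S Y) (d : A -> signal S (option nat)),
  fin_sig y -> (forall i, at_sig (d i)) -> fin_sig (fun a h => (conf y d (a :: h)).1).

(** A test needs a live register, so here every tree is a leaf and the control evolves as in a
    finite automaton. *)
Lemma solvable_registerless :
  (forall q, live q = set0) -> (forall y q, single_use live (live q) (tr y q)) -> solvable.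
Proof.
move=> live0 su y d cy _.
pose ctl (t : tree Q R A) q := if t is Ret q' _ then q' else q.
apply: (eq_fin_sig _ (fin_sig_scan q0 (fun q x => ctl (tr x q) q) cy)).
move=> a h /=; suff -> : scan q0 (fun q x => ctl (tr x q) q) y h = (conf y d h).1.
  have := su (y a h) (conf y d h).1; rewrite live0; case: (tr _ _) => //= r s t1 t0 [].
  by move=> /subsetP/(_ _ (mem_touched r s)); rewrite inE.
elim: h => //= b h ->.
have := su (y b h) (conf y d h).1; rewrite live0; case: (tr _ _) => //= r s t1 t0 [].
by move=> /subsetP/(_ _ (mem_touched r s)); rewrite inE.
Qed.

End Runs.

(** * Letters that carry a live set *)

Section Carry.
Variables (R Q A Y : finType) (live : Q -> {set R}) (tr : Y -> Q -> tree Q R A) (L : {set R}).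

(** Any test rules out carrying: under single use, started with live set [L], it would use up a
    register of [L]. *)
Definition untouched (t : tree Q R A) : option Q :=
  if t is Ret q' f then
    if (live q' == L) && [forall r in L, ~~ isSome (f r)] then Some q' else None
  else None.

Definition carry_map (y : Y) (q : Q) : option Q := untouched (tr y q).

Definition acts_idly (y : Y) : bool := [forall q, (live q == L) ==> (carry_map y q == Some q)].

Definition carry_image (y : Y) : {set Q} :=
  [set q' | [exists q, (live q == L) && (carry_map y q == Some q')]].

Lemma carryP y q q' : carry_map y q = Some q' ->
  exists f, [/\ tr y q = Ret q' f, live q' = L & {in L, f =1 fun=> None}].
Proof.
rewrite /carry_map; case: (tr y q) => //= p f; case: ifP => // /andP[/eqP lp /forall_inP H] [<-].
by exists f; split=> // r /H; case: (f r).
Qed.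

Lemma carried_in y q q' : live q = L -> carry_map y q = Some q' -> q' \in carry_image y.
Proof. by move=> lq cq; rewrite inE; apply/existsP; exists q; rewrite lq cq !eqxx. Qed.

Hypothesis su : forall y q, single_use live (live q) (tr y q).
Hypothesis Lmax : forall q, L \subset live q -> live q = L.

(** Every register of [L] was kept, so the old live set contains [L] and maximality applies. *)
Lemma carry_live y q q' : carry_map y q = Some q' -> live q = L.
Proof.
move=> /carryP[f [tE lq' fL]]; apply: Lmax; apply/subsetP => r rL.
by have := su y q; rewrite tE /=; apply; rewrite ?lq' ?fL.
Qed.

Definition fresh (f : R -> option A) : option R := [pick r in L | isSome (f r)].

Lemma freshP f x : fresh f = Some x -> x \in L /\ isSome (f x).
Proof. by rewrite /fresh; case: pickP => // z /andP[zL fz] [<-]. Qed.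

Lemma fresh_ex K t v u : single_use live K t -> ~~ (L \subset K) ->
  live (leaf v u t).1 = L -> exists x, fresh (leaf v u t).2 = Some x.
Proof.
move=> sut LK lL; rewrite /fresh; case: pickP => [x _|H]; first by exists x.
case/negP: LK; apply/subsetP => r rL; apply: (leaf_keep (v := v) (u := u) sut); rewrite ?lL //.
by have := H r; rewrite rL /=; case: ((leaf v u t).2 r).
Qed.

Lemma born_fresh y q v u : carry_map y q = None \/ live q != L ->
  live (leaf v u (tr y q)).1 = L -> exists x, fresh (leaf v u (tr y q)).2 = Some x.
Proof.
have [lq|lq] := eqVneq (live q) L; last first.
  by move=> _; apply: (fresh_ex (su y q)); apply: contraNN lq => /Lmax ->.
case=> // cq; move: cq (su y q); rewrite /carry_map lq; case: (tr y q) => [q' f|r s t1 t0] /=.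
  move=> + _ lq'; rewrite lq' eqxx /=; case: ifP => // /negbT; rewrite negb_forall_in.
  move=> /exists_inP[x xL fx] _; rewrite /fresh; case: pickP => [z _|/(_ x)]; first by exists z.
  by rewrite xL; case: (f x) fx.
move=> _ [sL su1 su0].
have LN : ~~ (L \subset L :\: touched r s).
  apply/negP => /subsetP/(_ r); rewrite inE mem_touched => /(_ (subsetP sL _ (mem_touched r s))).
  by [].
by case: ifP => _; [apply: fresh_ex su1 LN | apply: fresh_ex su0 LN].
Qed.

End Carry.

(** * Replacing a register by a slot of the letter *)

Section Substitution.
Variables (Q R A : finType) (E : {ffun A * A -> bool}) (x : R) (z : A).
Implicit Types (t : tree Q R A).

(** A node of a tree tests a register, so equality of two slots is decided by the table [E], which
    is supplied with the letter. *)
Definition compare (s1 s2 : R + A) t1 t0 : tree Q R A :=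
  match s1, s2 with
  | inl r, _ => Cmp r s2 t1 t0
  | inr i, inl r => Cmp r (inr i) t1 t0
  | inr i, inr j => if E (i, j) then t1 else t0
  end.

Definition subst_operand (s : R + A) : R + A :=
  if s is inl r then if r == x then inr z else inl r else s.

Definition subst_assign (f : R -> option A) : R -> option A :=
  fun r => if (r == x) && ~~ isSome (f r) then Some z else f r.

Fixpoint subst t : tree Q R A :=
  match t with
  | Ret q f => Ret q (subst_assign f)
  | Cmp r s t1 t0 =>
      compare (subst_operand (inl r)) (subst_operand s) (subst t1) (subst t0)
  end.

Lemma leaf_compare v u s1 s2 t1 t0 : (forall i j, E (i, j) = (u i == u j)) ->
  leaf v u (compare s1 s2 t1 t0) =
  if operand v u s1 == operand v u s2 then leaf v u t1 else leaf v u t0.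
Proof.
move=> EE; case: s1 s2 => [r|i] [r'|j] //=; first by rewrite eq_sym.
by rewrite EE; case: ifP.
Qed.

Definition subst_val v (u : A -> option nat) : R -> option nat :=
  fun r => if r == x then u z else v r.

Lemma operand_subst v u s : operand v u (subst_operand s) = operand (subst_val v u) u s.
Proof. by case: s => //= r; rewrite /subst_val; case: ifP. Qed.

Lemma leaf_subst v u t : (forall i j, E (i, j) = (u i == u j)) ->
  leaf v u (subst t) =
  ((leaf (subst_val v u) u t).1, subst_assign (leaf (subst_val v u) u t).2).
Proof.
move=> EE; elim: t => [//|r s t1 IH1 t0 IH0].
rewrite -[subst _]/(compare (subst_operand (inl r)) (subst_operand s) (subst t1) (subst t0)).
by rewrite leaf_compare // !operand_subst IH1 IH0 /=; case: ifP.
Qed.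

Lemma assign_subst v u f : assign v u (subst_assign f) =1 assign (subst_val v u) u f.
Proof.
move=> r; rewrite /assign /subst_assign /subst_val.
by case: eqP => /= _; case: (f r).
Qed.

Variable live : Q -> {set R}.

Definition registers (s : R + A) : {set R} := if s is inl r then [set r] else set0.

Lemma touchedE r s : touched r s = r |: registers s.
Proof. by case: s => [r2|i] //=; rewrite setU0. Qed.

Lemma single_use_compare (K : {set R}) s1 s2 t1 t0 : let D := registers s1 :|: registers s2 in
  D \subset K -> single_use live (K :\: D) t1 -> single_use live (K :\: D) t0 ->
  single_use live K (compare s1 s2 t1 t0).
Proof.
by case: s1 s2 => [r|i] [r'|j] /=; rewrite ?set0U ?setU0 ?setD0 //; case: ifP.
Qed.

Lemma registers_subst s : registers (subst_operand s) = registers s :\ x.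
Proof.
case: s => [r|i] /=; last by rewrite set0D.
case: eqVneq => [->|rx]; first by rewrite setDv.
by apply/setP => r'; rewrite !inE andbC; case: eqVneq => //= ->.
Qed.

Lemma single_use_subst K t : single_use live K t -> single_use live (K :\ x) (subst t).
Proof.
elim: t K => [q f|r s t1 IH1 t0 IH0] K.
  move=> H r rq; rewrite /= /subst_assign; case: eqP => [->|/eqP rx] /=.
    by case: (f x).
  by move=> /(H r rq) rK; rewrite !inE rx.
case=> sK /IH1 H1 /IH0 H0.
have DE : registers (subst_operand (inl r)) :|: registers (subst_operand s) = touched r s :\ x.
  by rewrite !registers_subst touchedE setDUl.
have DK : K :\ x :\: (touched r s :\ x) = K :\: touched r s :\ x.
  by apply/setP => r'; rewrite !inE; case: (_ == x) => //=; rewrite !andbF.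
by apply: single_use_compare; rewrite DE ?DK // setSD.
Qed.

End Substitution.

(** * Elimination of a maximal live set *)

Section Elimination.
Variables (S : pof) (R Q A Y : finType) (live : Q -> {set R}) (q0 : Q).
Variables (tr : Y -> Q -> tree Q R A) (L : {set R}) (k : nat).

Local Notation carry := (carry_map live tr L).
Local Notation idle := (acts_idly live tr L).
Local Notation carried := (carry_image live tr L).
Local Notation fresh := (@fresh R A L).
Local Notation guess := {ffun R -> bool}.
Local Notation names := {ffun 'I_k -> option Q}.
Local Notation Q3 := ((Q * {set R}) + option A)%type.
Local Notation Q2 := ('I_k + option (Q * option R * Q * guess * {set R}))%type.
Local Notation A2 := (A + Q * guess)%type.
Local Notation Y2 := (Y * names * {ffun A2 * A2 -> bool})%type.

Implicit Types (sym K : {set R}) (g : guess) (v : R -> option nat) (u : A -> option nat).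
Implicit Types (t : tree Q R A) (s : R + A) (h : seq (el S)).

(* In the second case the letter is the identity on names, and in the third
   one fewer than [k] names are carried to a name. *)
Definition next_names (y : Y) (e : names) : names :=
  if idle y then e
  else if injectiveb (fun n => obind (carry y) (e n)) &&
          [forall n, isSome (obind (carry y) (e n))]
       then [ffun n => obind (carry y) (e n)]
       else [ffun n : 'I_k => onth (enum (carried y)) n].

(** * Threads and the main automaton *)

Definition symbol (sym : {set R}) (r : R) (s : R + A) : option R :=
  if r \in sym then Some r
  else if s is inl r2 then if r2 \in sym then Some r2 else None else None.

(** A test on two inherited registers is recorded under the first only; by single use a bit is
    written at most once. *)
Definition record (g : guess) sym r s b : guess :=
  if symbol sym r s is Some x then [ffun z => if z == x then b else g z] else g.

Fixpoint recorded sym (g : guess) v u (t : tree Q R A) : guess :=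
  match t with
  | Ret _ _ => g
  | Cmp r s t1 t0 =>
      let b := v r == operand v u s in
      recorded sym (record g sym r s b) v u (if b then t1 else t0)
  end.

Definition remaining (sym : {set R}) q' (f : R -> option A) : {set R} :=
  [set r in sym | (r \in live q') && ~~ isSome (f r)].

Definition thread_end sym q' f : Q3 :=
  if live q' == L then inr (obind f (fresh f)) else inl (q', remaining sym q' f).

Fixpoint thread_tree (g : guess) sym (t : tree Q R A) : tree Q3 R A :=
  match t with
  | Ret q' f => Ret (thread_end sym q' f) f
  | Cmp r s t1 t0 =>
      if symbol sym r s is Some x
      then if g x then thread_tree g sym t1 else thread_tree g sym t0
      else Cmp r s (thread_tree g sym t1) (thread_tree g sym t0)
  end.

(** Inherited registers are not stored, and the empty set in the case [live q == L] keeps [L] out of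
    the live sets of threads. *)
Definition thread_live (c : Q3) : {set R} :=
  if c is inl (q, sym) then if live q == L then set0 else live q :\: sym else set0.

(* The thread [(p, g)] is restarted at each letter that is not idle, as if the
   control before that letter were [p]; results of tests on the inherited
   registers, which it does not store, are read from [g]. *)
Definition thread_tr (p : Q) (g : guess) (y : Y) (c : Q3) : tree Q3 R A :=
  if idle y then
    if c is inl (q, sym) then
      if live q == L then Ret (inr None) (fun=> None) else thread_tree g sym (tr y q)
    else Ret (inr None) (fun=> None)
  else if carry y p is Some _ then Ret (inr None) (fun=> None)
  else thread_tree g (live p) (tr y p).

Definition main_end (p : Q) sym (g : guess) q' f : Q2 :=
  if live q' == L then
    if fresh f is Some x then inr (Some (q', Some x, p, g, set0)) else inr None
  else inr (Some (q', None, p, g, remaining sym q' f)).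

Definition lift (f : R -> option A) : R -> option A2 := fun r => omap inl (f r).

Definition lift_operand (s : R + A) : R + A2 :=
  match s with inl r => inl r | inr i => inr (inl i) end.

Fixpoint main_tree p sym (g : guess) (t : tree Q R A) : tree Q2 R A2 :=
  match t with
  | Ret q' f => Ret (main_end p sym g q' f) (lift f)
  | Cmp r s t1 t0 =>
      Cmp r (lift_operand s) (main_tree p sym (record g sym r s true) t1)
        (main_tree p sym (record g sym r s false) t0)
  end.

(** For nonempty [L], the live set is [L] only at the [k] names, hence nowhere if [k = 0]; this is
    the base of the induction on [k]. *)
Definition main_live (c : Q2) : {set R} :=
  match c with
  | inl _ => L
  | inr None => set0
  | inr (Some (q, None, _, _, _)) => if live q == L then set0 else live q
  | inr (Some (q, Some x, _, _, _)) => if x \in L then L :\ x else set0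
  end.

Definition dead : tree Q2 R A2 := Ret (inr None) (fun=> None).

Definition main_name (e : names) (q : Q) (f : R -> option A2) : tree Q2 R A2 :=
  if [pick n | e n == Some q] is Some n then Ret (inl n) f else dead.

Definition no_guess : guess := [ffun=> false].

(* A control [inl n] stands for the configuration of live set [L] whose control
   is currently named [n], none of its registers having been used since it got
   a name.  A control [inr (Some (q, x, p, g, sym))] stands for the control
   [q]; [p] is the control just before the last non-idle letter, [sym] the set
   of registers not used since then, and [g] records the results of the tests
   performed on the others.  The register [x], if any, is not stored: its atom
   is found by the thread [(p, g)]. *)
Definition main_tr (x : Y2) (c : Q2) : tree Q2 R A2 :=
  let: (y, e, E) := x in
  let e' := next_names y e in
  match c with
  | inl n =>
      if idle y then Ret (inl n) (fun=> None)
      else if e n is Some q then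
        if live q == L then
          if carry y q is Some q' then main_name e' q' (fun=> None)
          else main_tree q L no_guess (tr y q)
        else dead
      else dead
  | inr None => dead
  | inr (Some (q, None, p, g, sym)) =>
      if live q == L then dead
      else if idle y then main_tree p sym g (tr y q)
      else main_tree q (live q) no_guess (tr y q)
  | inr (Some (q, Some x, p, g, sym)) =>
      if (live q == L) && (x \in L) then
        if idle y then Ret c (fun=> None)
        else if carry y q is Some q' then
          main_name e' q' (fun r => if r == x then Some (inr (p, g)) else None)
        else subst E x (inr (p, g)) (main_tree q L no_guess (tr y q))
      else dead
  end.

Definition main_init : Q2 := inr (Some (q0, None, q0, no_guess, set0)).

Hypothesis su : forall y q, single_use live (live q) (tr y q).
Hypothesis Lmax : forall q, L \subset live q -> live q = L.
Hypothesis L_neq0 : L != set0.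
Hypothesis live_q0 : live q0 = set0.
Hypothesis rank : forall y, idle y || (#|carried y| <= k).

(** * Correctness of the trees *)

Lemma symbol_some sym r s x : symbol sym r s = Some x -> x \in sym /\ x \in touched r s.
Proof.
rewrite /symbol; case: ifP => [rs [<-]|_]; first by rewrite rs mem_touched.
case: s => // r2; case: ifP => // r2s [<-]; rewrite r2s /= !inE eqxx orbT.
by [].
Qed.

Lemma symbol_none (sym : {set R}) r (s : R + A) x :
  symbol sym r s = None -> x \in touched r s -> x \notin sym.
Proof.
rewrite /symbol; case: ifP => // rs; case: s => [r2|a] /=.
  by case: ifP => // r2s _; rewrite !inE => /orP[] /eqP ->; rewrite ?rs ?r2s.
by move=> _; rewrite inE => /eqP ->; rewrite rs.
Qed.

(** Each bit written along [t] belongs to an inherited register that the test uses, hence one in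
    [K]. *)
Lemma recorded_out K sym g v u t r : single_use live K t -> r \notin K \/ r \notin sym ->
  recorded sym g v u t r = g r.
Proof.
elim: t K g => [//|r1 s t1 IH1 t0 IH0] K g [sK H1 H0] rKs /=.
have recE b : record g sym r1 s b r = g r.
  rewrite /record; case E: symbol => [x|//]; have [xs xt] := symbol_some E.
  rewrite ffunE; case: eqP => // rx; rewrite rx in rKs.
  by case: rKs; rewrite ?xs // (subsetP sK).
have rKs' : r \notin K :\: touched r1 s \/ r \notin sym.
  by case: rKs => H; [left; rewrite inE (negPf H) andbF|right].
by case: ifP => _; [rewrite (IH1 _ _ H1)|rewrite (IH0 _ _ H0)].
Qed.

Lemma operand_lift v v2 u (u2 : A2 -> option nat) (s : R + A) :
  (forall r, r \in registers s -> v2 r = v r) -> (forall i, u2 (inl i) = u i) ->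
  operand v2 u2 (lift_operand s) = operand v u s.
Proof. by case: s => [r|i] /= H1 H2; [rewrite H1 ?inE|]. Qed.

Lemma leaf_main K p sym g t v u v2 (u2 : A2 -> option nat) :
  single_use live K t -> {in K, v2 =1 v} ->
  (forall i, u2 (inl i) = u i) ->
  leaf v2 u2 (main_tree p sym g t) =
  (main_end p sym (recorded sym g v u t) (leaf v u t).1 (leaf v u t).2,
   lift (leaf v u t).2).
Proof.
move=> + + uE; elim: t K g => [//|r s t1 IH1 t0 IH0] K g [sK H1 H0] vE /=.
have vE' : {in K :\: touched r s, v2 =1 v} by move=> x; rewrite inE => /andP[_ /vE].
rewrite (@operand_lift v _ u) // => [|x xs]; last first.
  by apply/vE/(subsetP sK); rewrite touchedE !inE xs orbT.
rewrite (IH1 _ _ H1 vE') (IH0 _ _ H0 vE') vE ?(subsetP sK) ?mem_touched //.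
by case: (_ == operand _ _ _).
Qed.

(** With the bits recorded by the true run, the thread takes the same branch. The bits of the
    remaining registers have not been read yet and stay free for later letters. *)
Lemma leaf_thread K sym g g' t v u v3 : single_use live K t ->
  {in K :\: sym, v3 =1 v} ->
  (forall r, r \notin remaining sym (leaf v u t).1 (leaf v u t).2 ->
    g' r = recorded sym g v u t r) ->
  leaf v3 u (thread_tree g' sym t) =
  (thread_end sym (leaf v u t).1 (leaf v u t).2, (leaf v u t).2).
Proof.
elim: t K g => [//|r s t1 IH1 t0 IH0] K g [sK H1 H0] vE.
set b := v r == operand v u s.
pose tb := if b then t1 else t0.
have Hb : single_use live (K :\: touched r s) tb by rewrite /tb; case: ifP.
have vE' : {in (K :\: touched r s) :\: sym, v3 =1 v}.
  by move=> x; rewrite !inE => /and3P[xs _ xK]; apply: vE; rewrite inE xs.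
have lE : leaf v u (Cmp r s t1 t0) = leaf v u tb by rewrite /= -/b /tb; case: (b).
rewrite lE => gE.
have {}gE x : x \notin remaining sym (leaf v u tb).1 (leaf v u tb).2 ->
    g' x = recorded sym (record g sym r s b) v u tb x.
  by move=> /gE ->; rewrite /= -/b.
have IH : leaf v3 u (thread_tree g' sym tb) =
    (thread_end sym (leaf v u tb).1 (leaf v u tb).2, (leaf v u tb).2).
  move: Hb vE' gE; rewrite /tb; case: (b) => Hb vE' gE;
    [exact: IH1 Hb vE' gE|exact: IH0 Hb vE' gE].
rewrite -IH /=; case E: symbol => [x|].
  have [xs xt] := symbol_some E.
  (* The register [x] has just been used, so it is not remaining and its bit is not rewritten. *)
  suff -> : g' x = b by rewrite /tb; case: (b).
  rewrite gE; last first.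
    rewrite inE xs /=; apply/negP => /andP[xl]; case fx: (_ x) => // _.
    by have := leaf_keep Hb xl fx; rewrite inE xt.
  rewrite (recorded_out _ _ _ Hb); last by left; rewrite inE xt.
  by rewrite /record E ffunE eqxx.
have vt x : x \in touched r s -> v3 x = v x.
  by move=> xt; apply: vE; rewrite inE (symbol_none E xt) (subsetP sK).
rewrite /= vt ?mem_touched //; have -> : operand v3 u s = operand v u s.
  by case: s vt {IH lE gE H1 H0 tb Hb b vE' sK E} => [r2|i] //= vt; rewrite vt // !inE eqxx orbT.
by rewrite -/b /tb; case: (b).
Qed.

(** * Preservation of single use *)

Lemma single_use_thread_tree K sym g t :
  single_use live K t -> single_use thread_live (K :\: sym) (thread_tree g sym t).
Proof.
elim: t K => [q f|r s t1 IH1 t0 IH0] K /=.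
  move=> H r; rewrite /thread_end; case: ifP => [_|lq] /=; first by rewrite inE.
  rewrite lq !inE => /andP[rs rl] fr; rewrite (H r rl fr) andbT.
  by move: rs; rewrite rl fr /= andbT.
case=> sK H1 H0; case E: symbol => [x|].
  have sub : (K :\: touched r s) :\: sym \subset K :\: sym by rewrite setSD ?subsetDl.
  by case: ifP => _; apply: single_use_sub sub _; [apply: IH1|apply: IH0].
have DE : (K :\: sym) :\: touched r s = (K :\: touched r s) :\: sym.
  by rewrite !setDDl setUC.
split; rewrite ?DE; [|exact: IH1|exact: IH0].
by apply/subsetP => x xt; rewrite inE (symbol_none E xt) (subsetP sK).
Qed.

Lemma single_use_thread p g y c :
  single_use thread_live (thread_live c) (thread_tr p g y c).
Proof.
rewrite /thread_tr; case: ifP => _.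
  case: c => [[q sym]|a] /=; last by move=> r; rewrite inE.
  by case: ifP => _; [move=> r; rewrite inE|exact: single_use_thread_tree].
case: carry => [q|]; first by move=> r; rewrite inE.
(* A restarted thread inherits all of [live p] and stores none of it. *)
by apply: single_use_sub (single_use_thread_tree _ _ (su y p)); rewrite setDv sub0set.
Qed.

Lemma single_use_main_tree K p sym g t :
  single_use live K t -> single_use main_live K (main_tree p sym g t).
Proof.
elim: t K g => [q f|r s t1 IH1 t0 IH0] K g /=.
  move=> H r rl fr; apply: H; last by move: fr; rewrite /lift; case: (f r).
  move: rl; rewrite /main_end; case: eqP => [lq|/eqP lq] /=; last by rewrite (negPf lq).
  case: (fresh f) => [x|] /=; last by rewrite inE.
  by case: ifP => _; rewrite ?inE // lq => /andP[].
have -> : touched r (lift_operand s) = touched r s by case: s.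
by case=> sK /IH1 H1 /IH0 H0.
Qed.

Lemma single_use_dead K : single_use main_live K dead.
Proof. by move=> r; rewrite inE. Qed.

Lemma single_use_name K e q f : {in L, forall r, f r = None -> r \in K} ->
  single_use main_live K (main_name e q f).
Proof.
by move=> H; rewrite /main_name; case: pickP => [n _|_]; [|exact: single_use_dead].
Qed.

Lemma single_use_main x c : single_use main_live (main_live c) (main_tr x c).
Proof.
case: x => -[y e] E.
have keep K (c' : Q2) : single_use main_live (main_live c') (Ret c' (fun=> None)) by move=> r.
case: c => [n|[[[[[q [x|]] p] g] sym]|]]; last exact: single_use_dead.
- rewrite /main_tr; case: ifP => _; first by move=> r.
  case: (e n) => [q|]; last exact: single_use_dead.
  case: eqP => [lq|_]; last exact: single_use_dead.
  case: (carry y q) => [q'|]; first exact: single_use_name.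
  by apply: single_use_main_tree; have := su y q; rewrite lq.
- rewrite /main_tr; case: ifP => [/andP[/eqP lq xL]|_]; last exact: single_use_dead.
  case: ifP => _; first by move=> r.
  have -> : main_live (inr (Some (q, Some x, p, g, sym))) = L :\ x by rewrite /= xL.
  case: (carry y q) => [q'|].
    by apply: single_use_name => r rL; rewrite !inE rL andbT; case: eqP.
  by apply/single_use_subst/single_use_main_tree; have := su y q; rewrite lq.
rewrite /main_tr [main_live _]/=; case: ifP => _; first exact: single_use_dead.
by case: ifP => _; apply: single_use_main_tree.
Qed.

(** * Names and the decrease of the rank *)

Lemma next_names_carried y e q : ~~ idle y -> q \in carried y ->
  exists n, next_names y e n = Some q.
Proof.
move=> ny qc; rewrite /next_names (negPf ny); case: ifP => [/andP[inj tot]|_].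
  (* The [k] names have distinct images in [carried y], which has at most [k] elements, so the
     images exhaust it. *)
  pose F n := odflt q0 (obind (carry y) (e n)).
  have FE n : obind (carry y) (e n) = Some (F n).
    by have := forallP tot n; rewrite /F; case: obind.
  have Finj : injective F.
    by move=> n m FF; apply: (injectiveP _ inj); rewrite !FE FF.
  have Fc : F @: setT \subset carried y.
    apply/subsetP => _ /imsetP[n _ ->]; have := FE n.
    by case: (e n) => //= p cp; apply: (carried_in _ cp); apply: (carry_live su Lmax cp).
  have : q \in F @: setT.
    suff -> : F @: setT = carried y by [].
    apply/eqP; rewrite eqEcard Fc card_imset // cardsT card_ord.
    by have := rank y; rewrite (negPf ny).
  by case/imsetP => n _ ->; exists n; rewrite ffunE FE.
have iq : index q (enum (carried y)) < k.
  have := rank y; rewrite (negPf ny) /=; apply: leq_trans.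
  by rewrite cardE index_mem mem_enum.
exists (Ordinal iq); rewrite ffunE /= onthE (nth_map q) ?nth_index ?mem_enum //.
by rewrite index_mem mem_enum.
Qed.

Lemma main_end_live p sym g q f : main_live (main_end p sym g q f) != L.
Proof.
rewrite /main_end; case: (boolP (live q == L)) => lq /=; last by rewrite (negPf lq).
case E: (fresh f) => [x|] /=; last by rewrite eq_sym.
have [xL _] := freshP E; rewrite xL; apply/eqP => /setP/(_ x).
by rewrite !inE xL eqxx.
Qed.

Lemma main_liveL c : main_live c = L -> exists n, c = inl n.
Proof.
case: c => [n|[[[[[q [x|]] p] g] sym]|]] /=; first by exists n.
- case: ifP => [xL|_] /setP H; first by have := H x; rewrite !inE xL eqxx.
  by case/eqP: L_neq0; apply/setP.
- by case: eqP => // _ H; case/eqP: L_neq0.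
by move=> H; case/eqP: L_neq0.
Qed.

Local Notation main_carry := (carry_map main_live main_tr L).

Lemma main_carryE y e E n : ~~ idle y ->
  main_carry (y, e, E) (inl n) =
  obind (fun q => omap inl [pick n | next_names y e n == Some q]) (obind (carry y) (e n)).
Proof.
move=> ny; rewrite -[LHS]/(untouched main_live L (main_tr (y, e, E) (inl n))) /main_tr (negPf ny).
have deadE : untouched main_live L dead = None by rewrite /= eq_sym (negPf L_neq0).
case: (e n) => [q|] //; case: (boolP (live q == L)) => [lq|nlq]; last first.
  rewrite deadE /=; case cq: (carry y q) => [q'|//].
  by move: nlq; rewrite (carry_live su Lmax cq) eqxx.
rewrite -[obind (carry y) _]/(carry y q); case: (carry y q) => [q'|] /=.
  rewrite /main_name; case: pickP => [m _|_]; last by rewrite deadE.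
  by rewrite /= eqxx /=; case: forall_inP => // -[].
by case: (tr y q) => //= q' f; rewrite (negPf (main_end_live _ _ _ _ _)).
Qed.

(** A partial map on [k] names with [k] values is total and injective; [next_names] then moves the
    names along with the controls, so that the letter fixes every name. Otherwise a value is
    lost. *)
Lemma main_rank x :
  acts_idly main_live main_tr L x || (#|carry_image main_live main_tr L x| <= k.-1).
Proof.
case: x => -[y e] E; apply/orP.
have [iy|ny] := boolP (idle y).
  left; apply/forallP => c; apply/implyP => /eqP/main_liveL[n ->].
  rewrite /carry_map /main_tr iy /= eqxx /=.
  by case: forall_inP => // -[].
have [/andP[inj tot]|ngood] := boolP (injectiveb (fun n => obind (carry y) (e n)) &&
    [forall n, isSome (obind (carry y) (e n))]).
  left; apply/forallP => c; apply/implyP => /eqP/main_liveL[n ->].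
  rewrite main_carryE //; have := forallP tot n; case cE: obind => [q|//] _ /=.
  rewrite /next_names (negPf ny) inj tot /=; case: pickP => [m|/(_ n)].
    by rewrite ffunE -cE => /eqP/(injectiveP _ inj) ->.
  by rewrite ffunE cE eqxx.
right; rewrite leqNgt; apply: contra ngood => kc.
pose F n := main_carry (y, e, E) (inl n).
have sub : [set Some c | c in carry_image main_live main_tr L (y, e, E)] \subset F @: setT.
  apply/subsetP => _ /imsetP[c + ->]; rewrite inE => /existsP[c' /andP[/eqP/main_liveL[n ->]]].
  by move=> /eqP <-; apply: imset_f; rewrite inE.
have cF : #|F @: setT| <= k by rewrite (leq_trans (leq_imset_card _ _)) // cardsT card_ord.
have cS : k <= #|[set Some c | c in carry_image main_live main_tr L (y, e, E)]|.
  by rewrite card_imset; [exact: leq_trans (leqSpred k) kc|exact: Some_inj].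
have FE : [set Some c | c in carry_image main_live main_tr L (y, e, E)] = F @: setT.
  by apply/eqP; rewrite eqEcard sub (leq_trans cF).
have Finj : injective F.
  have : #|F @: setT| == #|[set: 'I_k]| by rewrite eqn_leq leq_imset_card cardsT card_ord -FE.
  by move=> /imset_injP inj n m; apply: inj; rewrite inE.
have tot n : isSome (obind (carry y) (e n)).
  have : F n \in F @: setT by apply: imset_f; rewrite inE.
  rewrite -FE => /imsetP[c _]; rewrite /F main_carryE //.
  by case: (obind (carry y) _).
apply/andP; split; last exact/forallP.
by apply/injectiveP => n m nm; apply: Finj; rewrite /F !main_carryE // nm.
Qed.

(** * The simulation invariant *)

Section Simulation.
Variables (y : signal S Y) (d : A -> signal S (option nat)).

Let src := conf q0 tr y d.
Let thr p g := conf (inl (q0, set0)) (thread_tr p g) y d.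

Let born p g a h : option A := if (thr p g (a :: h)).1 is inr o then o else None.
Let put p g : signal S bool := fun a h => isSome (born p g a h).
Let use : signal S bool := fun a h => ~~ idle (y a h).
Let birth p g : signal S (option nat) :=
  fun a h => if born p g a h is Some i then d i a h else None.
(** Filled at the birth found by the thread [(p, g)], and read by the letter that closes the
    block. *)
Let cell p g := memory (put p g) use (birth p g).

Let named := scan ([ffun=> None] : names) (fun e x => next_names x e) y.

Let d2 (i : A2) : signal S (option nat) := fun a h =>
  match i with
  | inl i => d i a h
  | inr (p, g) => if use a h then cell p g h else None
  end.

Let y2 : signal S Y2 := fun a h =>
  (y a h, named h, [ffun ij => d2 ij.1 a h == d2 ij.2 a h]).

Let img := conf main_init main_tr y2 d2.

(** While the live set is not [L], the condition concerns all guesses [g'] that agree with [g]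
    outside [sym]: the bits of [sym] are still open, and whatever values they get, some thread must
    have followed the run. *)
Let simulates h : Prop :=
  match (img h).1 with
  | inl n =>
      [/\ named h n = Some (src h).1, live (src h).1 = L & {in L, (img h).2 =1 (src h).2}]
  | inr None => False
  | inr (Some (q, None, p, g, sym)) =>
      [/\ q = (src h).1, live q != L, {in live q, (img h).2 =1 (src h).2} &
        forall g', (forall r, r \notin sym -> g' r = g r) ->
          (thr p g' h).1 = inl (q, sym) /\
          {in live q :\: sym, (thr p g' h).2 =1 (src h).2}]
  | inr (Some (q, Some x, p, g, _)) =>
      [/\ q = (src h).1, live q = L, x \in L, {in L :\ x, (img h).2 =1 (src h).2} &
        cell p g h = (src h).2 x /\ exists o, (thr p g h).1 = inr o]
  end.

(** The step shared by all letters at which the configuration is not carried; [v2] is the valuation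
    with the missing register, if any, restored. *)
Lemma simulates_start a h p sym g v2 :
  let q := (src h).1 in let t := tr (y a h) q in let u := fun i => d i a h in
  let l := leaf (src h).2 u t in
  {in live q, v2 =1 (src h).2} -> carry (y a h) q = None \/ live q != L ->
  (forall g', (forall r, r \notin sym -> g' r = g r) ->
    thread_tr p g' (y a h) (thr p g' h).1 = thread_tree g' sym t /\
    {in live q :\: sym, (thr p g' h).2 =1 (src h).2}) ->
  (img (a :: h)).1 = main_end p sym (recorded sym g (src h).2 u t) l.1 l.2 ->
  (img (a :: h)).2 =1 assign v2 (fun i => d2 i a h) (lift l.2) ->
  simulates (a :: h).
Proof.
move=> q t u l v2E cq thrE img1 img2.
have srcE : src (a :: h) = (l.1, assign (src h).2 u l.2) by [].
set g1 := recorded _ _ _ _ _ in img1.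
have keepK r : r \in live l.1 -> l.2 r = None -> r \in live q.
  exact: leaf_keep (su (y a h) q).
have thrE' g' : (forall r, r \notin remaining sym l.1 l.2 -> g' r = g1 r) ->
    thr p g' (a :: h) = (thread_end sym l.1 l.2, assign (thr p g' h).2 u l.2).
  move=> gE; have [] := thrE g'.
    move=> r rs; rewrite gE ?inE ?(negPf rs) //.
    by apply: recorded_out (su (y a h) q) _; right.
  move=> tE vE; rewrite /thr /= /next_conf -/(thr p g' h) tE.
  by rewrite (leaf_thread (su (y a h) q) vE gE).
have valE r : r \in live l.1 -> (img (a :: h)).2 r = (src (a :: h)).2 r.
  move=> rl; rewrite img2 srcE /= /assign /lift; case fr: (l.2 r) => [i|] //=.
  exact: v2E (keepK _ rl fr).
rewrite /simulates img1 /main_end; case: eqP => [lL|/eqP lL].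
  have [x fx] : exists x, fresh l.2 = Some x by apply: (born_fresh su Lmax cq).
  have [xL] := freshP fx; case lx: (l.2 x) => [i|] // _; rewrite fx.
  have tE := thrE' g1 (fun _ _ => erefl).
  have teE : thread_end sym l.1 l.2 = inr (Some i) by rewrite /thread_end lL eqxx fx /= lx.
  split=> // [r|].
    by rewrite inE => /andP[_ rL]; apply: valE; rewrite lL.
  split; last by exists (Some i); rewrite tE teE.
  rewrite /cell /= /put /birth /born tE /= teE /=.
  by rewrite /assign lx.
split=> // g' gE; rewrite thrE' // /thread_end (negPf lL); split=> // r.
rewrite !inE srcE /= /assign => /andP[rs rl]; case fr: (l.2 r) => [//|].
have [|_ ->//] := thrE g'.
  move=> z zs; rewrite gE ?inE ?(negPf zs) //.
  by apply: recorded_out (su (y a h) q) _; right.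
rewrite inE keepK // andbT; move: rs; rewrite rl fr /= andbT.
by [].
Qed.

Lemma idle_carry x q : idle x -> live q = L -> carry x q = Some q.
Proof. by move=> /forallP/(_ q)/implyP H lq; apply/eqP/H; rewrite lq. Qed.

Lemma src_carry a h q : carry (y a h) (src h).1 = Some q ->
  [/\ (src (a :: h)).1 = q, live q = L & {in L, (src (a :: h)).2 =1 (src h).2}].
Proof.
move=> /carryP[f [tE lq fL]]; rewrite /src /= /next_conf -/(src h) tE /=; split=> // r rL.
by rewrite /assign fL.
Qed.

(** All live registers are inherited at a restart, so the agreement of valuations is vacuous. *)
Lemma thread_restart a h : ~~ idle (y a h) -> carry (y a h) (src h).1 = None ->
  forall g', (forall r, r \notin live (src h).1 -> g' r = no_guess r) ->
  thread_tr (src h).1 g' (y a h) (thr (src h).1 g' h).1 =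
    thread_tree g' (live (src h).1) (tr (y a h) (src h).1) /\
  {in live (src h).1 :\: live (src h).1, (thr (src h).1 g' h).2 =1 (src h).2}.
Proof.
move=> ny cN g' _; split; last by move=> r; rewrite setDv inE.
by rewrite /thread_tr (negPf ny) cN.
Qed.

Lemma simulatesP h : simulates h.
Proof.
elim: h => [|a h].
  rewrite /simulates /=; split=> //; first by rewrite live_q0 eq_sym.
have u2E (i : A) : d2 (inl i) a h = d i a h by [].
have nameE q : ~~ idle (y a h) -> carry (y a h) (src h).1 = Some q ->
    exists2 n, named (a :: h) n = Some q & forall f,
    main_name (next_names (y a h) (named h)) q f = Ret (inl n) f.
  move=> ny cq; have lq := carry_live su Lmax cq.
  have [n nq] := next_names_carried (named h) ny (carried_in lq cq).
  rewrite /main_name; case: pickP => [m /eqP mq|/(_ n)]; last by rewrite nq eqxx.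
  by exists m.
have imgE (t : tree Q2 R A2) : main_tr (y2 a h) (img h).1 = t -> img (a :: h) =
    next_conf (img h) (fun i => d2 i a h) t by move=> <-.
rewrite {1}/simulates; case imgc: (img h).1 => [n|[[[[[q [x|]] p] g] sym]|]] //.
- case=> nq lq vE; have [iy|ny] := boolP (idle (y a h)).
    have [q1 _ v1] := src_carry (idle_carry iy lq).
    have nE : named (a :: h) = named h by rewrite /named /= /next_names iy.
    rewrite /simulates nE; move: (src (a :: h)) q1 v1 => c q1 v1.
    rewrite (imgE (Ret (inl n) (fun=> None))) /=; last by rewrite imgc /= iy.
    by rewrite q1; split=> // r rL; rewrite v1 // -vE.
  case cq: (carry (y a h) (src h).1) => [q'|].
    have [q1 lq' v1] := src_carry cq; have [m mq mE] := nameE _ ny cq.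
    rewrite /simulates; move: (src (a :: h)) (named _) q1 v1 mq => c e q1 v1 mq.
    rewrite (imgE (Ret (inl m) (fun=> None))) /=; last first.
      by rewrite imgc /= (negPf ny) nq lq eqxx cq mE.
    by rewrite q1; split=> // r rL; rewrite v1 // -vE.
  have {}imgE := imgE (main_tree (src h).1 (live (src h).1) no_guess (tr (y a h) (src h).1)).
  have {}vE : {in live (src h).1, (img h).2 =1 (src h).2} by rewrite lq.
  apply: (simulates_start (v2 := (img h).2) vE (or_introl cq) (thread_restart ny cq)).
    rewrite imgE /=; last by rewrite imgc /= (negPf ny) nq lq eqxx cq.
    by rewrite (leaf_main _ _ _ (su _ _) vE u2E).
  rewrite imgE /=; last by rewrite imgc /= (negPf ny) nq lq eqxx cq.
  by rewrite (leaf_main _ _ _ (su _ _) vE u2E).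
- case=> qE lq xL vE [cE [o thrE]]; rewrite qE in imgc lq.
  have [iy|ny] := boolP (idle (y a h)).
    have [q1 _ v1] := src_carry (idle_carry iy lq).
    (* A stopped thread writes nothing at idle letters, so the cell keeps the atom. *)
    have thr1 : (thr p g (a :: h)).1 = inr None.
      by rewrite /thr /= -/(thr p g h) thrE /thread_tr iy.
    have c1 : cell p g (a :: h) = cell p g h.
      by rewrite {1}/cell /= /put /use /born thr1 iy.
    rewrite /simulates; move: (src (a :: h)) q1 v1 => c q1 v1.
    rewrite (imgE (Ret (inr (Some ((src h).1, Some x, p, g, sym))) (fun=> None)));
      last by rewrite imgc /= lq eqxx xL iy.
    cbn [fst snd next_conf leaf]; rewrite q1 c1; split=> // [r rLx|].
      have rL : r \in L by move: rLx; rewrite inE => /andP[].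
      by rewrite v1 // -vE.
    by rewrite v1 // -cE thr1; split; last exists None.
  (* The letter closes the block, so the slot [(p, g)] delivers the atom of [x]. *)
  have zE : d2 (inr (p, g)) a h = (src h).2 x by rewrite /d2 /use ny cE.
  pose v2 := subst_val x (inr (p, g)) (img h).2 (fun i => d2 i a h).
  have v2E : {in L, v2 =1 (src h).2}.
    move=> r rL; rewrite /v2 /subst_val; case: eqP => [->|/eqP rx]; first by rewrite zE.
    by apply: vE; rewrite !inE rx.
  case cq: (carry (y a h) (src h).1) => [q'|].
    have [q1 lq' v1] := src_carry cq; have [m mq mE] := nameE _ ny cq.
    rewrite /simulates; move: (src (a :: h)) (named _) q1 v1 mq => c e q1 v1 mq.
    rewrite (imgE (Ret (inl m)
        (fun r => if r == x then Some (inr (p, g)) else None))) /=; last first.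
      by rewrite imgc /= lq eqxx xL (negPf ny) cq mE.
    rewrite q1; split=> // r rL.
    rewrite v1 // -v2E // /assign /v2 /subst_val.
    by case: eqP.
  have {}imgE := imgE (subst [ffun ij => d2 ij.1 a h == d2 ij.2 a h] x (inr (p, g))
    (main_tree (src h).1 (live (src h).1) no_guess (tr (y a h) (src h).1))).
  have {}v2E : {in live (src h).1, v2 =1 (src h).2} by rewrite lq.
  have EE i j : [ffun ij => d2 ij.1 a h == d2 ij.2 a h] (i, j) = (d2 i a h == d2 j a h).
    by rewrite ffunE.
  apply: (simulates_start (v2 := v2) v2E (or_introl cq) (thread_restart ny cq)).
    rewrite imgE /=; last by rewrite imgc /= lq eqxx xL (negPf ny) cq.
    by rewrite leaf_subst // (leaf_main _ _ _ (su _ _) v2E u2E).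
  move=> r; rewrite imgE /=; last by rewrite imgc /= lq eqxx xL (negPf ny) cq.
  rewrite leaf_subst // assign_subst.
  by rewrite (leaf_main _ _ _ (su _ _) v2E u2E).
case=> qE lq vE thrE; rewrite qE in imgc lq vE thrE.
have [iy|ny] := boolP (idle (y a h)).
  have {}imgE := imgE (main_tree p sym g (tr (y a h) (src h).1)).
  apply: (simulates_start (v2 := (img h).2) (p := p) (sym := sym) (g := g) vE (or_intror lq)).
  - move=> g' /thrE[tE vtE]; split=> //.
    by rewrite tE /thread_tr iy (negPf lq).
  - rewrite imgE /=; last by rewrite imgc /= (negPf lq) iy.
    by rewrite (leaf_main _ _ _ (su _ _) vE u2E).
  - rewrite imgE /=; last by rewrite imgc /= (negPf lq) iy.
    by rewrite (leaf_main _ _ _ (su _ _) vE u2E).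
have {}imgE := imgE (main_tree (src h).1 (live (src h).1) no_guess (tr (y a h) (src h).1)).
have cq : carry (y a h) (src h).1 = None.
  case cq: carry => [q'|//]; by move: lq; rewrite (carry_live su Lmax cq) eqxx.
apply: (simulates_start (v2 := (img h).2) vE (or_introl cq) (thread_restart ny cq)).
  rewrite imgE /=; last by rewrite imgc /= (negPf lq) (negPf ny).
  by rewrite (leaf_main _ _ _ (su _ _) vE u2E).
rewrite imgE /=; last by rewrite imgc /= (negPf lq) (negPf ny).
by rewrite (leaf_main _ _ _ (su _ _) vE u2E).
Qed.

Lemma fin_sig_source : fin_sig y -> (forall i, at_sig (d i)) ->
  (forall p g, solvable S (inl (q0, set0)) (thread_tr p g)) ->
  solvable S main_init main_tr -> fin_sig (fun a h => (src (a :: h)).1).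
Proof.
move=> cy cd cthr cimg.
have cborn p g : fin_sig (born p g).
  exact: (fin_sig_map (fun c : Q3 => if c is inr o then o else None) (cthr p g _ _ cy cd)).
have cuse : fin_sig use := fin_sig_map (fun x => ~~ idle x) cy.
have cd2 i : at_sig (d2 i).
  case: i => [i|[p g]]; first exact: cd.
  apply: (at_sig_memory _ cuse); first exact: (fin_sig_map (fun o => isSome o) (cborn p g)).
  exact: (at_sig_select (cborn p g) cd).
have cE : fin_sig (fun a h => [ffun ij : A2 * A2 => d2 ij.1 a h == d2 ij.2 a h]).
  by apply: fin_sig_ffun => ij; apply: fin_sig_eq.
have cnamed : fin_sig (fun _ h => named h) := fin_sig_prev _ _ cy.
have cy2 : fin_sig y2 := fin_sig_map2 pair (fin_sig_map2 pair cy cnamed) cE.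
(* A named control is looked up in the table of names; by the invariant, the default [q0] is never
   returned. *)
pose ctl (e : names) (c : Q2) : Q :=
  match c with
  | inl n => odflt q0 (e n)
  | inr (Some (q, _, _, _, _)) => q
  | inr None => q0
  end.
have cnamed' : fin_sig (fun a h => named (a :: h)) := fin_sig_scan _ _ cy.
apply: (eq_fin_sig _ (fin_sig_map2 ctl cnamed' (cimg _ _ cy2 cd2))) => a h.
have := simulatesP (a :: h); rewrite /simulates /img.
case: (conf _ _ _ _ _).1 => [n|[[[[[q [x|]] p] g] sym]|]] //=; last 2 first.
- by case.
- by case.
by case=> ->.
Qed.

End Simulation.

Lemma solvable_elimination :
  (forall p g, solvable S (inl (q0, set0)) (thread_tr p g)) ->
  solvable S main_init main_tr -> solvable S q0 tr.
Proof. by move=> cthr cimg y d cy cd; apply: fin_sig_source. Qed.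

End Elimination.

(** * Induction on the family of live sets *)

Theorem solvable_single_use S (R : finType) (LL : {set {set R}}) :
  (forall K K' : {set R}, K' \subset K -> K \in LL -> K' \in LL) ->
  forall (Q A Y : finType) (live : Q -> {set R}) q0 (tr : Y -> Q -> tree Q R A),
  (forall q, live q \in LL) -> live q0 = set0 ->
  (forall y q, single_use live (live q) (tr y q)) -> solvable S q0 tr.
Proof.
(* Outer induction on the size of the family, from which a largest set [L] is removed. *)
elim: {LL}#|LL|.+1 {-2}LL (ltnSn #|LL|) => // m IHm LL LLm down.
have [/exists_inP[K0 K0LL K0n0]|] := boolP [exists K in LL, K != set0]; last first.
  rewrite negb_exists_in => /forall_inP LL0 Q A Y live q0 tr liveLL _ su.
  apply: (@solvable_registerless S R Q A Y live q0 tr _ su) => q.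
  by apply/eqP; have := LL0 _ (liveLL q); rewrite negbK.
pose L := [arg max_(K > K0 in LL) #|K|].
have [LLL Lcard] : L \in LL /\ forall K, K \in LL -> #|K| <= #|L|.
  by rewrite /L; case: arg_maxnP => // K KLL H.
have Ln0 : L != set0.
  by rewrite -card_gt0 (leq_trans _ (Lcard _ K0LL)) // card_gt0.
have Lmax K : K \in LL -> L \subset K -> K = L.
  by move=> KLL LK; apply/eqP; rewrite eq_sym eqEcard LK Lcard.
have L0 : set0 \in LL by apply: down LLL; rewrite sub0set.
have downL (K K' : {set R}) : K' \subset K -> K \in LL :\ L -> K' \in LL :\ L.
  rewrite !inE => KK' /andP[KL KLL]; rewrite (down _ _ KK' KLL) andbT.
  by apply: contraNN KL => /eqP K'L; rewrite (Lmax K) // -K'L.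
have cardL : #|LL :\ L| < m by move: LLm; rewrite (cardsD1 L) LLL.
have LD x : x \in L -> L :\ x \in LL :\ L.
  move=> xL; rewrite !inE (down L) ?subD1set // andbT.
  by apply/eqP => /setP/(_ x); rewrite !inE eqxx xL.
have L0D : set0 \in LL :\ L by rewrite !inE eq_sym Ln0.
(* Inner induction on the rank [k]; the value [#|Q|] bounds the rank of every letter. *)
suff H k : forall (Q A Y : finType) (live : Q -> {set R}) q0 (tr : Y -> Q -> tree Q R A),
    (forall q, live q \in LL) -> live q0 = set0 ->
    (forall y q, single_use live (live q) (tr y q)) ->
    (forall y, acts_idly live tr L y || (#|carry_image live tr L y| <= k)) -> solvable S q0 tr.
  move=> Q A Y live q0 tr liveLL lq0 su.
  by apply: (H #|Q| _ _ _ _ _ _ liveLL lq0 su) => y; rewrite max_card orbT.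
have cthr (Q A Y : finType) (live : Q -> {set R}) q0 (tr : Y -> Q -> tree Q R A) p g :
    (forall q, live q \in LL) -> live q0 = set0 ->
    (forall y q, single_use live (live q) (tr y q)) ->
    solvable S (inl (q0, set0)) (thread_tr live tr L p g).
  move=> liveLL lq0 su.
  apply: (IHm (LL :\ L) cardL downL _ _ _ (thread_live live L)).
  - case=> [[q sym]|o] //=; case: eqP => // /eqP lq.
    by apply: (downL (live q)); rewrite ?subsetDl // !inE lq liveLL.
  - by rewrite /= lq0 eq_sym (negPf Ln0) set0D.
  - exact: single_use_thread.
elim: k => [|k IHk] Q A Y live q0 tr liveLL lq0 su rank.
  have Lmax' q : L \subset live q -> live q = L by apply: Lmax.
  apply: (solvable_elimination su Lmax' Ln0 lq0 rank) => [p g|]; first exact: cthr su.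
  (* Without names, [L] is not a live set of the main automaton and the outer induction applies. *)
  apply: (IHm (LL :\ L) cardL downL _ _ _ (main_live live L (k := 0))).
  - case=> [[]//|[[[[[q [x|]] p] g] sym]|]] //=; first by case: ifP => // xL; apply: LD.
    by case: eqP => // /eqP lq; rewrite !inE lq liveLL.
  - by rewrite /= lq0 eq_sym (negPf Ln0).
  - by move=> y c; apply: single_use_main.
have Lmax' q : L \subset live q -> live q = L by apply: Lmax.
apply: (solvable_elimination su Lmax' Ln0 lq0 rank) => [p g|]; first exact: cthr su.
apply: (IHk _ _ _ (main_live live L (k := k.+1))).
- case=> [n|[[[[[q [x|]] p] g] sym]|]] //=.
    by case: ifP => // xL; have := LD _ xL; rewrite inE => /andP[].
  by case: ifP.
- by rewrite /= lq0 eq_sym (negPf Ln0).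
- by move=> y c; apply: single_use_main.
by move=> y; apply: (main_rank su Lmax' Ln0).
Qed.

(** * Single-use Mealy machines *)

(** The orbit of [x] has at most [#|T|] elements, so a fixed point on it is reached within [#|T|]
    steps. *)
Lemma iter_absorbing (T : finType) (f : T -> T) (P : pred T) x j :
  (forall z, P z -> f z = z) -> P (iter j f x) -> iter #|T| f x = iter j f x.
Proof.
move=> fix_f Pj; have xj : fconnect f x (iter j f x) := fconnect_iter f j x.
have le : findex f x (iter j f x) <= #|T|.
  by rewrite ltnW // (leq_trans (findex_max xj)) // max_card.
rewrite -(subnK le) iterD iter_findex //.
by elim: (_ - _) => //= i ->; apply: fix_f.
Qed.

Lemma leaf_omap (Q R A : finType) pi v v' (u u' : A -> option nat) (t : tree Q R A) :
  injective pi -> (forall r, v' r = omap pi (v r)) -> (forall i, u' i = omap pi (u i)) ->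
  leaf v' u' t = leaf v u t.
Proof.
move=> inj vE uE; elim: t => //= r s t1 -> t0 ->.
have -> : operand v' u' s = omap pi (operand v u s) by case: s.
by rewrite vE (inj_eq (omap_inj inj)).
Qed.

Lemma get_all_some s xs : get_all s = Some xs -> s = map Some xs.
Proof.
elim: s xs => [|[x|] s IH] xs //=; first by case=> <-.
by case: (get_all s) IH => //= ys IH [<-] /=; rewrite -IH.
Qed.

Lemma get_all_omap pi s : get_all (map (omap pi) s) = omap (map pi) (get_all s).
Proof. by elim: s => [|[x|] s IH] //=; rewrite IH; case: get_all. Qed.

Lemma get_all_size s xs : get_all s = Some xs -> size xs = size s.
Proof. by move=> /get_all_some ->; rewrite size_map. Qed.

Lemma foldr_upd n (rs : seq 'I_n) (v : 'I_n -> option nat) r :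
  foldr (fun r v' => upd v' r None) v rs r = if r \in rs then None else v r.
Proof.
elim: rs => //= r' rs IH; rewrite {1}/upd in_cons IH.
by case: eqP.
Qed.

(** * The tree of one letter *)

Section Macro.
Variables (S G : pof) (M : sumealy S G).
Hypothesis wfM : wf_sumealy M.

Local Notation state := ('I_(nstates M)).
Local Notation reg := ('I_(nregs M)).
Local Notation slot := (state * bool)%type.
(* The content of a register while a letter is processed: [None] is the
   undefined value, [Some None] the atom held when the head reached the letter,
   [Some (Some p)] the atom stored by the action [p]. *)
Local Notation tags := {ffun reg -> option (option slot)}.
Local Notation control := (option (state * {set reg} * option (slot * tags))).
Local Notation letter := ({ffun state -> bool} * {ffun slot * slot -> bool} *
  {ffun slot -> bool})%type.

(** Slots are the transitions of the machine, which makes the atoms that a letter can contribute a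
    finite family. *)
Definition stored (p : slot) (a : el S) : option nat :=
  if (Defs.next M p.1 p.2).2 is AStore f _ then f a else None.

Definition behaviour (a : el S) : letter :=
  ([ffun q => if question_of M q is QTest f then f a else false],
   [ffun pp => stored pp.1 a == stored pp.2 a],
   [ffun p => isSome (stored p a)]).

Lemma stored_act pi : bijective pi -> forall p a, stored p (act pi S a) = omap pi (stored p a).
Proof.
move=> bpi [q b] a; rewrite /stored /=; have [_ /(_ b)] := wfM q.
by case: (Defs.next M q b).2 => //= f _; apply.
Qed.

Lemma behaviour_act pi : bijective pi -> forall a, behaviour (act pi S a) = behaviour a.
Proof.
move=> bpi a; congr (_, _, _); apply/ffunP => x; rewrite !ffunE.
- by have [+ _] := wfM x; case: (question_of M x) => //= f; apply.
- by rewrite !stored_act // (inj_eq (omap_inj (bij_inj bpi))).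
- by rewrite stored_act //; case: (stored x a).
Qed.

Definition set_tag (tg : tags) r x : tags := [ffun r' => if r' == r then x else tg r'].

Definition tag_operand (tg : tags) (r : reg) : option (reg + slot) :=
  omap (fun x => if x is Some p then inr p else inl r) (tg r).

(** At an output, the new control remembers the transition and the tags of that moment, from which
    the output letter is recovered. *)
Definition after (y : letter) (q : state) (b : bool) (tg : tags) : state * tags + control :=
  match (Defs.next M q b).2 with
  | AStore _ r =>
      inl ((Defs.next M q b).1, set_tag tg r (if y.2 (q, b) then Some (Some (q, b)) else None))
  | AOut rs _ =>
      inr (Some ((Defs.next M q b).1, [set r | (r \notin rs) && isSome (tg r)], Some ((q, b), tg)))
  end.

Definition live (c : control) : {set reg} := if c is Some (_, K, _) then K else set0.

Definition final_assign (c : control) (r : reg) : option slot :=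
  if c is Some (_, _, Some (_, tg)) then if tg r is Some (Some p) then Some p else None
  else None.

Fixpoint macro_tree n (y : letter) (u : state * tags) : tree control reg slot :=
  if n is n'.+1 then
    let go x := match x with
                | inl u' => macro_tree n' y u'
                | inr c => Ret c (final_assign c)
                end in
    match question_of M u.1 with
    | QTest _ => go (after y u.1 (y.1.1 u.1) u.2)
    | QEq r1 r2 =>
        let tg := set_tag (set_tag u.2 r1 None) r2 None in
        match tag_operand u.2 r1, tag_operand u.2 r2 with
        | Some s1, Some s2 =>
            compare y.1.2 s1 s2 (go (after y u.1 true tg)) (go (after y u.1 false tg))
        | _, _ => Ret None (fun=> None)
        end
    end
  else Ret None (fun=> None).

Definition initial_tags (K : {set reg}) : tags := [ffun r => if r \in K then Some None else None].

(* A computation on one letter that is longer than the number of its possible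
   stages loops, which totality excludes. *)
Definition macro_tr (y : letter) (c : control) : tree control reg slot :=
  if c is Some (q, K, _)
  then macro_tree #|{: state * tags + control}| y (q, initial_tags K)
  else Ret None (fun=> None).

(** A test clears the tags of its registers, so an atom held since before the letter is tested at
    most once. *)
Lemma single_use_macro_tree n y (u : state * tags) (K : {set reg}) :
  (forall r, u.2 r = Some None -> r \in K) -> single_use live K (macro_tree n y u).
Proof.
elim: n u K => [|n IH] u K uK /=; first by move=> r; rewrite inE.
have H b (tg : tags) (K' : {set reg}) : (forall r, tg r = Some None -> r \in K') ->
    single_use live K' match after y u.1 b tg with
      | inl u' => macro_tree n y u' | inr c => Ret c (final_assign c) end.
  move=> tK; rewrite /after; case: (Defs.next M u.1 b).2 => [f r|rs f].
    apply: IH => r' /=; rewrite ffunE; case: eqP => [_|_ /tK //].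
    by case: ifP.
  move=> r /=; rewrite inE => /andP[_]; case tr: (tg r) => [[p|]|] // _ _.
  exact: tK.
case: (question_of M u.1) => [f|r1 r2]; first exact: H.
rewrite /tag_operand; case t1: (u.2 r1) => [x1|] /=; last by move=> r; rewrite inE.
case t2: (u.2 r2) => [x2|] /=; last by move=> r; rewrite inE.
set tg := set_tag _ _ _.
have RK r (x : option slot) : u.2 r = Some x ->
    registers (if x is Some p then inr p else inl r) \subset K.
  by case: x => [p|] ur /=; rewrite ?sub0set // sub1set uK.
have tgK r : tg r = Some None -> r \in K :\: (registers (if x1 is Some p then inr p else inl r1)
   :|: registers (if x2 is Some p then inr p else inl r2)).
  rewrite !ffunE; case: eqP => // /eqP rr2; case: eqP => // /eqP rr1 /uK rK.
  rewrite !inE rK andbT negb_or.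
  by case: (x1) (x2) => [p1|] [p2|]; rewrite /= !inE ?rr1 ?rr2.
apply: single_use_compare; first by rewrite subUset !RK.
  exact: H.
exact: H.
Qed.

Lemma single_use_macro y c : single_use live (live c) (macro_tr y c).
Proof.
case: c => [[[q K] o]|] /=; last by move=> r; rewrite inE.
by apply: single_use_macro_tree => r /=; rewrite ffunE; case: ifP.
Qed.

(** * Agreement with the steps of the machine *)

Section Letter.
Variables (a : el S) (v0 : reg -> option nat).
Let u (p : slot) := stored p a.
Let y := behaviour a.

Definition micro (x : state * tags + control) : state * tags + control :=
  match x with
  | inl (q, tg) =>
      match question_of M q with
      | QTest _ => after y q (y.1.1 q) tg
      | QEq r1 r2 =>
          match tag_operand tg r1, tag_operand tg r2 with
          | Some s1, Some s2 =>
              after y q (operand v0 u s1 == operand v0 u s2)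
                (set_tag (set_tag tg r1 None) r2 None)
          | _, _ => inr None
          end
      end
  | inr c => inr c
  end.

Definition outcome (x : state * tags + control) : control :=
  if x is inr c then c else None.

Lemma leaf_macro_tree n x : leaf v0 u (macro_tree n y x) =
  let c := outcome (iter n micro (inl x)) in (c, final_assign c).
Proof.
elim: n x => [|n IH] [q tg] //; rewrite iterSr.
have goE z : leaf v0 u match z with
      | inl u' => macro_tree n y u' | inr c => Ret c (final_assign c) end =
    let c := outcome (iter n micro z) in (c, final_assign c).
  case: z => [x|c]; first exact: IH.
  by have -> : iter n micro (inr c) = inr c by elim: n {IH} => //= n ->.
rewrite [micro _]/= [macro_tree _ _ _]/=.
case: (question_of M q) => [f|r1 r2]; first exact: goE.
case: (tag_operand tg r1) => [s1|]; last first.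
  by have -> : iter n micro (inr None) = inr None by elim: n {IH goE} => //= n ->.
case: (tag_operand tg r2) => [s2|]; last first.
  by have -> : iter n micro (inr None) = inr None by elim: n {IH goE} => //= n ->.
rewrite leaf_compare => [|i j]; last by rewrite ffunE.
by case: ifP => _; apply: goE.
Qed.

Definition content (tg : tags) (r : reg) : option nat :=
  if tg r is Some x then if x is Some p then stored p a else v0 r else None.

Lemma content_operand (tg : tags) r x : content tg r = Some x ->
  exists2 s, tag_operand tg r = Some s & operand v0 u s = Some x.
Proof.
rewrite /content /tag_operand; case: (tg r) => [[p|]|] //= H.
  by exists (inr p).
by exists (inl r).
Qed.

Lemma content_clear (tg : tags) r r' :
  content (set_tag tg r None) r' = if r' == r then None else content tg r'.
Proof. by rewrite /content ffunE; case: eqP. Qed.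

Definition output_of (p : slot) (v : reg -> option nat) : option (el G) :=
  if (Defs.next M p.1 p.2).2 is AOut rs f then omap f (get_all (map v rs)) else None.

Definition output_regs (p : slot) : seq reg :=
  if (Defs.next M p.1 p.2).2 is AOut rs _ then rs else [::].

Lemma answer_micro q v b v1 (tg : tags) : v =1 content tg ->
  answer (question_of M q) v a = Some (b, v1) ->
  exists2 tg1 : tags, micro (inl (q, tg)) = after y q b tg1 & v1 =1 content tg1 /\
    forall r, tg1 r = Some None -> tg r = Some None.
Proof.
move=> vE; rewrite /micro; case qE: (question_of M q) => [f|r1 r2] /=.
  by case=> <- <-; exists tg; rewrite // ffunE qE.
case v1E: (v r1) => [x1|//]; case v2E: (v r2) => [x2|//] [<- <-].
rewrite vE in v1E; rewrite vE in v2E.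
have [s1 -> ->] := content_operand v1E; have [s2 -> ->] := content_operand v2E.
exists (set_tag (set_tag tg r1 None) r2 None); first by [].
split=> r; first by rewrite !content_clear /upd vE.
by rewrite !ffunE; case: ifP => // _; case: ifP.
Qed.

(** Induction on the run up to its first output. No action creates the tag [Some None], so a
    register with this tag still holds its old atom. *)
Lemma runs_letter q v w out : runs M q v (a :: w) out ->
  forall tg : tags, v =1 content tg ->
  exists j q' (K : {set reg}) p (tg' : tags),
    iter j micro (inl (q, tg)) = inr (Some (q', K, Some (p, tg'))) /\
  exists z out' v', [/\ out = z :: out', output_of p (content tg') = Some z,
    (forall r, tg' r = Some None -> tg r = Some None),
    (forall r, r \in K -> r \notin output_regs p /\ isSome (tg' r)) &
    runs M q' v' w out' /\ v' =1 fun r => if r \in K then content tg' r else None].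
Proof.
move E: (a :: w) => aw R; elim: R E => {q v aw out} [//|q v a' w' b v1 v2 out|
  q v a' w' b v1 v2 z out] ans per R IH [? ?] tg vE; subst a' w'.
  have [tg1 micE [v1E sub]] := answer_micro vE ans.
  move: per R IH; case nE: (Defs.next M q b) => [q2 [f r|rs f]] /=; last by case: get_all.
  case=> <- R IH.
  pose tg2 := set_tag tg1 r (if y.2 (q, b) then Some (Some (q, b)) else None).
  have [|j [q' [K [p [tg' [iE [z [out' [v' [outE oE tgE KE RE]]]]]]]]]] := IH erefl tg2.
    move=> r'; rewrite /upd /content ffunE; case: eqP => [_|_]; last exact: v1E.
    have sE : stored (q, b) a = f a by rewrite /stored nE.
    by rewrite ffunE sE; case fE: (f a) => [x|] //=; rewrite sE fE.
  exists j.+1, q', K, p, tg'; split; first by rewrite iterSr micE /after nE.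
  exists z, out', v'; split=> // r' /tgE; rewrite ffunE; case: ifP => [_|_ /sub //].
  by case: ifP.
have [tg1 micE [v1E sub]] := answer_micro vE ans.
move: per R IH; case nE: (Defs.next M q b) => [q2 [f r|rs f]] //=.
case gE: get_all => [xs|//] [<- <-] R _.
have gE' : get_all (map (content tg1) rs) = Some xs by rewrite -gE; congr get_all; apply: eq_map.
exists 1, q2, [set r | (r \notin rs) && isSome (tg1 r)], (q, b), tg1; split.
  by rewrite -[LHS]/(micro (inl (q, tg))) micE /after nE.
exists (f xs), out, (foldr (fun r v' => upd v' r None) v1 rs); split=> //.
- by rewrite /output_of nE /= gE'.
- by move=> r; rewrite /output_regs nE /= inE => /andP.
split=> // r; rewrite foldr_upd inE; case: ifP => //= _; rewrite v1E.
by case: ifP => //; rewrite /content; case: (tg1 r).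
Qed.

End Letter.

(** * The output from the control and the cells *)

Definition outcome_tags (c : control) (r : reg) : option (option slot) :=
  if c is Some (_, K, Some (_, tg)) then if r \in K then tg r else None else None.

Definition read_regs a (c : control) (v : reg -> option nat) : option (el G) :=
  if c is Some (_, _, Some (p, tg)) then output_of p (content a v tg) else None.

Lemma eq_read_regs a c v v' : v =1 v' -> read_regs a c v = read_regs a c v'.
Proof.
move=> vv'; case: c => [[[q K] [[p tg]|]]|] //=; rewrite /output_of.
case: (_.2) => // rs f; congr (omap f (get_all _)); apply: eq_map => r.
by rewrite /content; case: (tg r) => [[x|]|].
Qed.

Lemma read_regs_act pi a c v : bijective pi ->
  read_regs (act pi S a) c (fun r => omap pi (v r)) = omap (act pi G) (read_regs a c v).
Proof.
move=> bpi; case: c => [[[q K] [[p tg]|]]|] //=; rewrite /output_of.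
have [_ /(_ p.2)] := wfM p.1; case: (_.2) => // rs f [_ fE].
have -> : map (content (act pi S a) (fun r => omap pi (v r)) tg) rs =
    map (omap pi) (map (content a v tg) rs).
  rewrite -map_comp; apply: eq_map => r /=; rewrite /content.
  by case: (tg r) => [[x|]|] //=; rewrite stored_act.
rewrite get_all_omap; case gE: get_all => [xs|] //=; rewrite fE //.
by rewrite (get_all_size gE) size_map.
Qed.

Definition run (h : seq (el S)) : control * (reg -> option nat) :=
  conf (Some (init M, set0, None)) macro_tr (fun a _ => behaviour a)
    (fun p a _ => stored p a) h.

Lemma run_cons a h : run (a :: h) =
  next_conf (run h) (fun p => stored p a) (macro_tr (behaviour a) (run h).1).
Proof. by rewrite /run conf_cons. Qed.

Definition put r : signal S bool := fun a h =>
  isSome (obind id (outcome_tags (run (a :: h)).1 r)).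

(** The tag [Some None] says that [r] keeps its old atom through the letter; otherwise the cell is
    vacated, in particular when [r] is output. *)
Definition release r : signal S bool := fun a h =>
  outcome_tags (run (a :: h)).1 r != Some None.

Definition new r : signal S (option nat) := fun a h =>
  if obind id (outcome_tags (run (a :: h)).1 r) is Some p then stored p a else None.

Definition cell r := memory (put r) (release r) (new r).

Lemma cell_cons r a h : cell r (a :: h) =
  if put r a h then new r a h else if release r a h then None else cell r h.
Proof. by []. Qed.

Definition read r : signal S (option nat) := fun a h =>
  if release r a h then cell r h else None.

Definition out : signal S (option (el G)) := fun a h =>
  read_regs a (run (a :: h)).1 (fun r => read r a h).

(** The registers of the machine are tracked twice: by [run] on its live set [K], which determines
    the control, and by the cells, from which the output is read. *)
Lemma trace_runs w h q v o K z : runs M q v w o ->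
  (run h).1 = Some (q, K, z) -> v =1 (fun r => if r \in K then (run h).2 r else None) ->
  (forall r, cell r h = v r) -> trace out h w = map Some o.
Proof.
elim: w h q v o K z => [|a w IH] h q v o K z R runE vE cellE.
  by inversion R.
have vE' : v =1 content a (run h).2 (initial_tags K).
  by move=> r; rewrite vE /content ffunE; case: ifP.
have [j [q' [K' [p [tg' [iE [b [o' [v' [oE outE tgE KE [R' v'E]]]]]]]]]]] := runs_letter R vE'.
have runE' : run (a :: h) = (Some (q', K', Some (p, tg')),
    assign (run h).2 (fun p => stored p a) (final_assign (Some (q', K', Some (p, tg'))))).
  rewrite run_cons /next_conf runE /macro_tr leaf_macro_tree.
  set f := micro a (run h).2; set x := inl _.
  (* Whatever [j] is, the output stage is absorbing, so the depth of [macro_tr] suffices to reach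
     it. *)
  have -> : iter #|{: state * tags + control}| f x = iter j f x.
    apply: (iter_absorbing (P := fun x => if x is inr _ then true else false)).
      by case.
    by rewrite iE.
  by rewrite iE.
have oldK r : tg' r = Some None -> r \in K.
  by move=> /tgE; rewrite ffunE; case: ifP.
have otE r : outcome_tags (run (a :: h)).1 r = if r \in K' then tg' r else None.
  by rewrite runE'.
have vK r : r \in K -> v r = (run h).2 r by rewrite vE => ->.
rewrite oE map_cons -/(trace _ _ _) -[LHS]/(out a h :: trace out (a :: h) w); congr cons.
  rewrite -outE /out runE' /= /output_of.
  move: KE; rewrite /output_regs; case: (Defs.next M p.1 p.2).2 => [f r|rs f] KE //.
  congr (omap f (get_all _)); apply/eq_in_map => r rrs.
  rewrite /content; case tr: (tg' r) => [[x|]|] //.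
  (* An old atom that is output is released at this letter, so [read] delivers it. *)
  rewrite /read; have -> : release r a h; last by rewrite cellE vK // oldK.
  by rewrite /release otE; case: ifP => // /KE[]; rewrite rrs.
apply: (IH _ q' v' _ K' (Some (p, tg')) R'); first by rewrite runE'.
  move=> r; rewrite v'E runE' /= /assign /=; case: ifP => // /KE[_ +].
  by rewrite /content; case: (tg' r) => [[x|]|].
move=> r; rewrite v'E cell_cons /put /new /release otE.
case: (boolP (r \in K')) => [/KE[_]|_ //=]; rewrite /content; case tr: (tg' r) => [[x|]|] //= _.
by rewrite cellE vK // oldK.
Qed.

Lemma fin_sig_run : fin_sig (fun a h => (run (a :: h)).1).
Proof.
apply: (@solvable_single_use S _ setT _ _ _ _ live (Some (init M, set0, None)) macro_tr) => //.
- by move=> K K' _ _; rewrite inE.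
- by move=> c; rewrite inE.
- exact: single_use_macro.
- exact: (fin_sig_input behaviour_act).
- by move=> p; apply: at_sig_input => pi bpi a; apply: stored_act.
Qed.

Lemma at_sig_read r : at_sig (read r).
Proof.
have ctags : fin_sig (fun a h => outcome_tags (run (a :: h)).1 r).
  exact: (fin_sig_map (fun c => outcome_tags c r) fin_sig_run).
apply: at_sig_memory.
- exact: (fin_sig_map (fun o => isSome (obind id o)) ctags).
- exact: (fin_sig_map (fun o => o != Some None) ctags).
apply: at_sig_select; first exact: (fin_sig_map (obind id) ctags).
by move=> p; apply: at_sig_input => pi bpi a; apply: stored_act.
Qed.

Lemma run_act pi a : bijective pi -> (run [:: act pi S a]).1 = (run [:: a]).1.
Proof.
move=> bpi; rewrite !run_cons behaviour_act // /next_conf.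
by rewrite (leaf_omap (v := fun=> None) (u := fun p => stored p a) _ (bij_inj bpi)) //= => p;
  apply: stored_act.
Qed.

Lemma trace_total (f : seq (el S) -> seq (el G)) w :
  su_computes M w (f w) -> trace out [::] w = map Some (f w).
Proof.
move=> R; apply: (trace_runs (v := fun=> None) (K := set0) (z := None) R) => // r.
by rewrite inE.
Qed.

Lemma prime_comp_total (f : seq (el S) -> seq (el G)) :
  (forall w, su_computes M w (f w)) ->
  exists g : seq (el S) -> seq (el G), prime_comp g /\ forall w, f w = g w.
Proof.
move=> fM; pose first a := read_regs a (run [:: a]).1 (fun=> None).
(* By totality the word [[:: a]] has an output; it depends equivariantly on [a] and serves as the
   default letter. *)
have default a : {z | first a = Some z}.
  case fE: (first a) => [z|]; first by exists z.
  exfalso; have := trace_total (fM [:: a]); case: (f _) => [|z o] //= [+ _].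
  have -> : out a [::] = first a by apply: eq_read_regs => r; rewrite /read; case: (release _ _ _).
  by rewrite fE.
pose H a c v := odflt (sval (default a)) (read_regs a c v).
have eq_default : equivariant (fun a => sval (default a)).
  move=> pi bpi a; suff: Some (sval (default (act pi S a))) =
    omap (act pi G) (Some (sval (default a))) by case.
  by rewrite -!(svalP (default _)) /first run_act // -read_regs_act.
have [g [pg gE]] : @computable S G (fun a h => odflt (sval (default a)) (out a h)).
  apply: (computable_output (H := H) eq_default) fin_sig_run at_sig_read.
    by move=> a c v v' vv'; rewrite /H (eq_read_regs _ _ vv').
  move=> pi bpi a c v; rewrite /H read_regs_act //; case: (read_regs a c v) => //=.
  exact: eq_default.
exists g; split=> // w; rewrite gE.
by rewrite (trace_odflt (fun a => sval (default a)) (trace_total (fM w))).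
Qed.

End Macro.

Theorem theorem2 (S G : pof) (M : sumealy S G) (f : seq (el S) -> seq (el G)) :
  wf_sumealy M ->
  (forall w, su_computes M w (f w)) ->
  exists g : seq (el S) -> seq (el G), prime_comp g /\ forall w, f w = g w.
Proof. by move=> wfM fM; exact: (prime_comp_total wfM fM). Qed.
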